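(* Let $\{X_n\}_{n\in\mathbb Z}$ be a stationary and ergodic finitarily Markovian process with values in a finite or countably infinite alphabet $\mathcal X$, and let $\chi_n$ be the backward memory length estimator (a function of $X_{-n}^0$) defined in the context. Then, almost surely, $\chi_n=K(X_{-\infty}^0)$ for all sufficiently large $n$.
   Context: Notation: $X_m^n=(X_m,\dots,X_n)$ for $m\le n$, and $X_m^n$ is the empty string if $m>n$; similarly for deterministic strings. $p(x_{-k}^0)=P(X_{-k}^0=x_{-k}^0)$ and $p(y|x_{-k}^0)=P(X_1=y\mid X_{-k}^0=x_{-k}^0)$; for the empty string $\emptyset$, $p(\emptyset)=1$ and $p(y|\emptyset)=P(X_1=y)$. Memory length: $K(X_{-\infty}^0)$ is the smallest $0\le K<\infty$ such that for all $i\ge1$, $y\in\mathcal X$, $z_{-K-i+1}^{-K}\in\mathcal X^i$ one has $p(y|X_{-K+1}^0)=p(y|z_{-K-i+1}^{-K},X_{-K+1}^0)$ provided $p(z_{-K-i+1}^{-K},X_{-K+1}^0,y)>0$; $K(X_{-\infty}^0)=\infty$ if there is no such $K$. The process is finitarily Markovian if $K(X_{-\infty}^0)<\infty$ almost surely. Empirical quantities (functions of $X_{-n}^0$): for $w_{-k+1}^0\in\mathcal X^k$ and $x\in\mathcal X$, $$\hat p_n(x|w_{-k+1}^0)=\frac{\#\{-n+k-1\le t\le -1: X_{t-k+1}^{t+1}=(w_{-k+1}^0,x)\}}{\#\{-n+k-1\le t\le -1: X_{t-k+1}^{t}=w_{-k+1}^0\}}.$$ Fix $0<\gamma<1$ and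 $0<\beta<\frac{1-\gamma}{2}$. Let $$\mathcal L_k^n=\{x_{-k}^0\in\mathcal X^{k+1}: \#\{-n+k\le t\le 0: X_{t-k}^t=x_{-k}^0\}>n^{1-\gamma}\},$$ $$\hat\Delta_k^n(w_{-k+1}^0)=\max_{1\le i\le n}\ \max_{(z_{-k-i+1}^{-k},w_{-k+1}^0,x)\in\mathcal L_{k+i}^n}\left|\hat p_n(x|w_{-k+1}^0)-\hat p_n(x|z_{-k-i+1}^{-k},w_{-k+1}^0)\right|,$$ where the maximum is over $i$, $z_{-k-i+1}^{-k}\in\mathcal X^i$ and $x\in\mathcal X$ with the displayed membership, and $\hat\Delta_k^n(w_{-k+1}^0)=0$ if there are no such triples. Set $NTEST_n(w_{-k+1}^0)=YES$ if $\hat\Delta_k^n(w_{-k+1}^0)\le n^{-\beta}$ and $NO$ otherwise. Estimator: $\chi_0=0$, and for $n\ge1$, $\chi_n$ is the smallest $0\le k<n$ such that $NTEST_n(X_{-k+1}^0)=YES$ if there is such a $k$, and $\chi_n=n$ otherwise. *)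

(* Defs.v *)
From HB Require Import structures.
From mathcomp Require Import all_boot all_order all_algebra.
From mathcomp Require Import all_classical all_reals all_analysis.

Set Implicit Arguments.
Unset Strict Implicit.
Unset Printing Implicit Defensive.

Import Order.TTheory GRing.Theory Num.Theory.
Import numFieldNormedType.Exports.

Local Open Scope classical_set_scope.
Local Open Scope ring_scope.

(* The integers a, a + 1, ..., b in increasing order; empty when a > b. *)
Definition zrange (a b : int) : seq int :=
  if a <= b then [seq a + i%:Z | i <- iota 0 (`|b - a|%N).+1] else [::].

(* The string x_m^n = (x_m, ..., x_n); the empty string when m > n. *)
Definition seg (A : Type) (x : int -> A) (m n : int) : seq A :=
  [seq x t | t <- zrange m n].

Definition shift (A : Type) (x : int -> A) : int -> A := fun t => x (t + 1).

(* The generators of the product sigma-algebra on A^Z, for A countable with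
   its discrete sigma-algebra. *)
Definition coord_events (A : Type) : set (set (int -> A)) :=
  [set C | exists (t : int) (a : A), C = [set x | x t = a]].

Section Process.
Context (d : measure_display) (T : measurableType d) (R : realType).
Variables (P : probability T R) (A : countType) (X : int -> T -> A).

Definition sample_path (omega : T) : int -> A := fun t => X t omega.

(* Every X_t is a random variable with values in the discrete space A. *)
Definition random_process : Prop :=
  forall (t : int) (a : A), measurable (X t @^-1` [set a]).

Definition stationary : Prop :=
  forall (m n s : int) (w : seq A),
    P [set omega | seg (sample_path omega) (m + s) (n + s) = w] =
    P [set omega | seg (sample_path omega) m n = w].

Definition ergodic : Prop :=
  forall C : set (int -> A), <<s @coord_events A >> C ->
    @shift A @^-1` C = C ->
    P (sample_path @^-1` C) = 0%E \/ P (sample_path @^-1` C) = 1%E.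

(* p(w), where w is placed at the times 1 - size w, ..., 0. *)
Definition prob_word (w : seq A) : R :=
  fine (P [set omega | seg (sample_path omega) (1 - (size w)%:Z) 0 = w]).

(* p(y | w); it has the junk value 0 when p(w) = 0. *)
Definition cond_prob (y : A) (w : seq A) : R :=
  fine (P [set omega | seg (sample_path omega) (1 - (size w)%:Z) 0 = w /\
                       X 1 omega = y]) / prob_word w.

(* The requirement on K in the definition of the memory length, for
   w = X_{-K+1}^0. *)
Definition memory_word (w : seq A) : Prop :=
  forall (i : nat) (y : A) (z : seq A), (1 <= i)%N -> size z = i ->
    0 < prob_word (z ++ rcons w y) ->
    cond_prob y w = cond_prob y (z ++ w).

Definition is_memory (x : int -> A) (K : nat) : bool :=
  `[< memory_word (seg x (- K%:Z + 1) 0) >].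

(* K(x_{-oo}^0), with None standing for an infinite memory length. *)
Definition memory_length (x : int -> A) : option nat :=
  if pselect (exists K, is_memory x K) is left h then Some (ex_minn h)
  else None.

Definition finitarily_markovian : Prop :=
  {ae P, forall omega, memory_length (sample_path omega) <> None}.

End Process.

Section Estimator.
Variables (R : realType) (A : countType) (gamma beta : R) (x : int -> A).

(* The empirical conditional probability of y after w; here k = size w. *)
Definition emp_prob (n : nat) (y : A) (w : seq A) : R :=
  let k := (size w)%:Z in
  let times := zrange (- n%:Z + k - 1) (- 1) in
  (count (fun t => seg x (t - k + 1) (t + 1) == rcons w y) times)%:R /
  (count (fun t => seg x (t - k + 1) t == w) times)%:R.

(* L_k^n; its elements have length k + 1. *)
Definition frequent (n k : nat) : set (seq A) :=
  [set s | size s = k.+1 /\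
    n%:R `^ (1 - gamma) <
      (count (fun t => seg x (t - k%:Z) t == s)
             (zrange (- n%:Z + k%:Z) 0))%:R :> R].

(* The maximum is written as a supremum; the set below is finite, since
   only finitely many strings occur in x_{-n}^0, and sup set0 = 0. *)
Definition emp_delta (n : nat) (w : seq A) : R :=
  sup [set r : R | exists (i : nat) (z : seq A) (y : A),
    [/\ (1 <= i <= n)%N, size z = i,
        frequent n (size w + i)%N (z ++ rcons w y) &
        r = `|emp_prob n y w - emp_prob n y (z ++ w)|]].

Definition ntest (n : nat) (w : seq A) : bool :=
  emp_delta n w <= n%:R `^ (- beta).

(* find returns the least k < n passing the test, and n if there is none. *)
Definition chi (n : nat) : nat :=
  find (fun k : nat => ntest n (seg x (- k%:Z + 1) 0)) (iota 0 n).

End Estimator.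

(* Main.v *)
Require Import Defs.
From HB Require Import structures.
From mathcomp Require Import all_boot all_order all_algebra.
From mathcomp Require Import all_classical all_reals all_analysis.
From mathcomp Require Import measurable_realfun.
From mathcomp Require Import ring lra zify.

Set Implicit Arguments.
Unset Strict Implicit.
Unset Printing Implicit Defensive.

Import Order.TTheory GRing.Theory Num.Theory.
Import numFieldNormedType.Exports.

Local Open Scope classical_set_scope.
Local Open Scope ring_scope.

(** The idea: call w a memory word if appending letters on its left never
    changes the law of the next letter. The memory length is the least K for
    which the last K letters of the past form such a word, and the estimator
    returns the least k whose word passes the test. So two facts suffice:
    almost surely, a word that is not a memory word eventually fails the test
    for good, and a memory word eventually passes it for good.

    Failure is a consequence of the ergodic theorem. Some extension z w of w
    gives a letter y a different probability, and the relative frequencies in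
    the window of the last n letters converge to these probabilities, so that
    the discrepancy stays above a positive constant while the threshold
    n^(- beta) tends to 0 (ntest_not_memory). Only indicators of words are
    needed, for which the ergodic theorem is proved directly
    (hits_suffix_cvg): for a threshold al above the probability of the word,
    the running maximum of the ergodic sums with al subtracted from each term
    obeys a one-sided recursion, taking expectations in one step of it gives the
    maximal inequality (lindley_maximal_inequality), and ergodicity turns the
    resulting bound below 1 into 0 (lindley_bounded).

    Passing is a large deviation estimate (prob_atypical_le). If w is a memory
    word, then at each occurrence of a word s that ends in w the next letter is
    y with probability p(y | w), whatever happened before. Betting on y at a
    subset of the occurrences of w, chosen without knowledge of the future,
    yields an exponential supermartingale, and a frequency after s that differs
    from p(y | w) by eps has probability of order exp (- eps^2 m / 8) if s y
    occurs more than m times (surplus_tail_bound). The words s and the letters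
    y compared by the test are random and unlimited in number. A random s is
    handled by its first occurrence in the window: the bettor waits for
    recurrences of whatever stands there, which leaves about n^2 betting rules
    (first_occurrence). For a random y the wealth is weighted by the number of
    bets won, which puts a factor p(y | w) into the bound, and these
    probabilities sum to at most 1 (gains_wealth_bound). With m = n^(1 - gamma)
    and eps = n^(- beta) / 2 the bounds are summable because
    1 - gamma - 2 beta > 0, and the Borel-Cantelli lemma applies
    (eventually_typical). *)

(** * Finite windows of a path *)
Section Windows.
Context (A : countType).
Implicit Types (x : int -> A) (t : int) (L : nat) (u s : seq A).

(** A window is described by its last time and its length in nat, so that
    prefixes and suffixes are given by take and drop and no case distinction on
    the order of two integer bounds is left. *)
Definition past x t L : seq A := mkseq (fun i => x (t - L%:Z + 1 + i%:Z)) L.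

Lemma size_past x t L : size (past x t L) = L.
Proof. by rewrite size_mkseq. Qed.

Lemma seg_past x (m n : int) L : n - m + 1 = L%:Z -> seg x m n = past x n L.
Proof.
move=> h; rewrite /seg /zrange /past /mkseq; case: ifPn => mn.
  have -> : (`|n - m|%N).+1 = L by lia.
  by rewrite -map_comp; apply: eq_map => i /=; congr x; lia.
by have -> : L = 0%N by lia.
Qed.

Lemma pastS_cons x t L : past x t L.+1 = x (t - L%:Z) :: past x t L.
Proof.
rewrite /past /mkseq /= (iotaDl 1 0) -map_comp; congr cons; first by congr x; lia.
by apply: eq_map => i /=; congr x; lia.
Qed.

Lemma pastS x t L : past x (t + 1) L.+1 = rcons (past x t L) (x (t + 1)).
Proof.
rewrite /past mkseqS; congr rcons; last by congr x; lia.
by apply: eq_mkseq => i; congr x; lia.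
Qed.

Lemma take_past x t L j : (j <= L)%N ->
  take j (past x t L) = past x (t - L%:Z + j%:Z) j.
Proof.
move=> jL; rewrite /past /mkseq -map_take take_iota (minn_idPl jL).
by apply: eq_map => i; congr x; lia.
Qed.

Lemma drop_past x t L j : (j <= L)%N -> drop j (past x t L) = past x t (L - j).
Proof.
move=> jL; rewrite /past /mkseq -map_drop drop_iota add0n.
rewrite (_ : iota j _ = map (addn j) (iota 0 (L - j))); last first.
  by rewrite -iotaDl addn0.
by rewrite -map_comp; apply: eq_map => i /=; congr x; lia.
Qed.

Lemma suffix_past x t L s : (size s <= L)%N ->
  suffix s (past x t L) = (past x t (size s) == s).
Proof.
move=> sL; rewrite suffixE size_past drop_past; last exact: leq_subr.
by rewrite subKn.
Qed.

Lemma past_shift x t L : past (Defs.shift x) t L = past x (t + 1) L.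
Proof. by apply: eq_mkseq => i; rewrite /Defs.shift; congr x; lia. Qed.

End Windows.

Arguments past : simpl never.

(** * Countable partitions *)
Section CountablePartitions.
Context (d : measure_display) (T : measurableType d) (R : realType)
  (P : {measure set T -> \bar R}) (I : countType).
Implicit Types F G : I -> set T.

(** Countable additivity speaks of sequences; the numbering of the index type
    turns any countable family into one. *)
Definition enum_family F (n : nat) : set T := oapp F set0 (pickle_inv n).

Lemma bigcup_enum_family F : \bigcup_n enum_family F n = \bigcup_i F i.
Proof.
apply/seteqP; split=> [w [n _]|w [i _ Fi]].
  by rewrite /enum_family; case: (pickle_inv n) => //= i Fi; exists i.
by exists (pickle i) => //; rewrite /enum_family pickleK_inv.
Qed.

Lemma measurable_enum_family F n :
  (forall i, measurable (F i)) -> measurable (enum_family F n).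
Proof.
by move=> mF; rewrite /enum_family; case: (pickle_inv n) => [i|] //=.
Qed.

Lemma trivIset_enum_family F :
  trivIset setT F -> trivIset setT (enum_family F).
Proof.
move=> /trivIsetP tF; apply/trivIsetP => m n _ _ mn; rewrite /enum_family.
case Em: (pickle_inv m) => [i|] /=; last by rewrite set0I.
case En: (pickle_inv n) => [j|] /=; last by rewrite setI0.
apply: tF => //; apply: contra mn => /eqP ij; apply/eqP.
have := @pickle_invK I m; have := @pickle_invK I n.
by rewrite Em En /= ij => -> ->.
Qed.

(** Subadditivity on the left and additivity on the right: only the dominating
    family has to be disjoint. *)
Lemma measure_le_countable F G (c : R) : 0 <= c ->
  (forall i, measurable (F i)) -> (forall i, measurable (G i)) ->
  trivIset setT G -> (forall i, (P (F i) <= c%:E * P (G i))%E) ->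
  (P (\bigcup_i F i) <= c%:E * P (\bigcup_i G i))%E.
Proof.
move=> c0 mF mG tG FG; rewrite -!bigcup_enum_family.
have mF' n := measurable_enum_family n mF.
have mG' n := measurable_enum_family n mG.
rewrite (le_trans (@measure_sigma_subadditive _ _ _ P _ _ mF' _ _))//.
  exact: bigcupT_measurable.
rewrite (measure_semi_bigcup P mG' (trivIset_enum_family tG)); last first.
  exact: bigcupT_measurable.
rewrite -nneseriesZl//; apply: lee_nneseries => // n _.
rewrite /enum_family; case: (pickle_inv n) => //=.
by rewrite !measure0 mule0.
Qed.

(** For functions of a window, with the partitions of the sample space by the
    word seen in it, this reduces a comparison of integrals to paths on which
    that word is given. *)
Lemma le_integral_countable F G (f g : T -> \bar R) :
  (forall i, measurable (F i)) -> (forall i, measurable (G i)) ->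
  trivIset setT F -> trivIset setT G ->
  \bigcup_i F i = setT -> \bigcup_i G i = setT ->
  measurable_fun setT f -> measurable_fun setT g ->
  (forall w, (0 <= f w)%E) -> (forall w, (0 <= g w)%E) ->
  (forall i, (\int[P]_(w in F i) f w <= \int[P]_(w in G i) g w)%E) ->
  (\int[P]_w f w <= \int[P]_w g w)%E.
Proof.
move=> mF mG tF tG UF UG mf mg f0 g0 fg.
rewrite -{1}UF -{1}UG -(bigcup_enum_family F) -(bigcup_enum_family G).
rewrite !ge0_integral_bigcup//.
- apply: lee_nneseries => [n _ _|n _]; first exact: integral_ge0.
  rewrite /enum_family; case: (pickle_inv n) => //=.
  by rewrite !integral_set0.
- by move=> n; apply: measurable_enum_family.
- exact: measurable_funS mg.
- exact: trivIset_enum_family.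
- by move=> n; apply: measurable_enum_family.
- exact: measurable_funS mf.
- exact: trivIset_enum_family.
Qed.

End CountablePartitions.

(** * Stationary processes seen through finite windows *)
Section StationaryProcess.
Context (d : measure_display) (T : measurableType d) (R : realType)
  (P : probability T R) (A : countType) (X : int -> T -> A).
Hypothesis hX : random_process X.
Implicit Types (t : int) (L : nat) (u s w : seq A) (B : set (seq A)).

Local Notation pastX t L := (fun omega => past (sample_path X omega) t L).
Local Notation q := (prob_word P X).

Lemma measurable_past_eq t L u : measurable (pastX t L @^-1` [set u]).
Proof.
elim: L t u => [|L IH] t u.
  have [->|u0] := eqVneq u [::].
    by rewrite (_ : _ @^-1` _ = setT)//; apply/seteqP; split.
  rewrite (_ : _ @^-1` _ = set0)//; apply/seteqP; split => // omega /= /esym.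
  by move/eqP; rewrite (negPf u0).
have -> : t = t - 1 + 1 by lia.
case/lastP: u => [|u y].
  by rewrite (_ : _ @^-1` _ = set0)//; apply/seteqP; split.
rewrite (_ : _ @^-1` _ = (pastX (t - 1) L @^-1` [set u]) `&`
    (X (t - 1 + 1) @^-1` [set y])); last first.
  apply/seteqP; split => omega /=; rewrite pastS.
    by move/rcons_inj => [].
  by move=> [-> <-].
by apply: measurableI; [exact: IH|exact: hX].
Qed.

(** The alphabet is countable, so every set of words of a window is an event
    and every function of a window is a random variable. *)
Lemma measurable_past t L B : measurable (pastX t L @^-1` B).
Proof.
rewrite (_ : _ @^-1` B = \bigcup_u (pastX t L @^-1` [set u] `&` [set _ | B u])).
  apply: countable_bigcupT_measurable => [|u]; first exact: countableP.
  apply: measurableI.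
    exact: measurable_past_eq.
  have [Bu|nBu] := pselect (B u).
    by rewrite (_ : [set _ | _] = setT)//; apply/seteqP; split.
  by rewrite (_ : [set _ | _] = set0)//; apply/seteqP; split.
apply/seteqP; split => omega /=; first by exists (pastX t L omega).
by move=> [u _ /= [<-]].
Qed.

Lemma measurable_fun_past t L (g : seq A -> R) :
  measurable_fun setT (fun omega => (g (pastX t L omega))%:E).
Proof.
by move=> _ Y mY; rewrite setTI; apply: (measurable_past t L [set u | Y (g u)%:E]).
Qed.

Lemma bigcup_past t L : \bigcup_u (pastX t L @^-1` [set u]) = setT.
Proof. by apply/seteqP; split => // omega _; exists (pastX t L omega). Qed.

Lemma trivIset_past t L : trivIset setT (fun u => pastX t L @^-1` [set u]).
Proof. by move=> u v _ _ [omega [/= -> ->]]. Qed.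

Hypothesis hstat : stationary P X.

Lemma prob_word_ge0 u : 0 <= q u.
Proof. exact: fine_ge0. Qed.

Lemma seg_pastE (m n : int) L u : n - m + 1 = L%:Z ->
  [set omega | seg (sample_path X omega) m n = u] = pastX n L @^-1` [set u].
Proof. by move=> h; apply/seteqP; split => omega /=; rewrite (seg_past _ h). Qed.

Lemma prob_past t u : P (pastX t (size u) @^-1` [set u]) = (q u)%:E.
Proof.
have h0 : 0 - (1 - (size u)%:Z) + 1 = (size u)%:Z by lia.
have ht : 0 + t - (1 - (size u)%:Z + t) + 1 = (size u)%:Z by lia.
rewrite /prob_word fineK; last first.
  by apply: fin_num_measure; rewrite (seg_pastE _ h0); exact: measurable_past_eq.
by rewrite -(hstat _ _ t) (seg_pastE _ ht) add0r.
Qed.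

(** Stationarity is assumed word by word; an event of the window is a countable
    disjoint union of words. *)
Lemma prob_past_shift t t' L B :
  P (pastX t L @^-1` B) = P (pastX t' L @^-1` B).
Proof.
suff le t1 t2 : (P (pastX t1 L @^-1` B) <= P (pastX t2 L @^-1` B))%E.
  by apply/eqP; rewrite eq_le !le.
pose F t u := if pselect (B u) then pastX t L @^-1` [set u] else set0.
have FE t0 : pastX t0 L @^-1` B = \bigcup_u F t0 u.
  apply/seteqP; split => omega /=.
    by move=> Bu; exists (pastX t0 L omega) => //; rewrite /F; case: pselect.
  by move=> [u _]; rewrite /F; case: pselect => //= Bu ->.
have mF t0 u : measurable (F t0 u).
  by rewrite /F; case: pselect => //= _; exact: measurable_past_eq.
rewrite !FE -[leRHS]mul1e; apply: measure_le_countable => //.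
  move=> u v _ _ [omega []]; rewrite /F.
  by case: pselect => //= _ <-; case: pselect => //= _ <-.
move=> u; rewrite mul1e /F; case: pselect => //= _.
have [->|Lu] := eqVneq L (size u); first by rewrite !prob_past.
rewrite (_ : _ @^-1` _ = set0) ?measure0//.
apply/seteqP; split => // omega /= pu; move/negP: Lu; apply.
by rewrite -pu size_past.
Qed.

Lemma integral_past_shift t t' L (g : seq A -> R) : (forall u, 0 <= g u) ->
  (\int[P]_omega (g (pastX t L omega))%:E =
   \int[P]_omega (g (pastX t' L omega))%:E)%E.
Proof.
move=> g0.
suff le t1 t2 : (\int[P]_omega (g (pastX t1 L omega))%:E <=
    \int[P]_omega (g (pastX t2 L omega))%:E)%E.
  by apply/eqP; rewrite eq_le !le.
apply: (@le_integral_countable _ _ _ _ _ (fun u => pastX t1 L @^-1` [set u])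
  (fun u => pastX t2 L @^-1` [set u])) => //.
- by move=> u; exact: measurable_past_eq.
- by move=> u; exact: measurable_past_eq.
- exact: trivIset_past.
- exact: trivIset_past.
- exact: bigcup_past.
- exact: bigcup_past.
- exact: measurable_fun_past.
- exact: measurable_fun_past.
- by move=> omega; rewrite lee_fin.
- by move=> omega; rewrite lee_fin.
move=> u.
have cst t0 : (\int[P]_(omega in pastX t0 L @^-1` [set u])
    (g (pastX t0 L omega))%:E =
    (g u)%:E * P (pastX t0 L @^-1` [set u]))%E.
  rewrite -integral_cst; last exact: measurable_past_eq.
  by apply: eq_integral => omega /=; rewrite inE /= => ->.
by rewrite !cst (prob_past_shift t1 t2).
Qed.

End StationaryProcess.

(** * Counting along a word *)
Section Counting.
Context (A : countType).
Implicit Types (h rho : pred (seq A)) (u : seq A) (x y : A).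

(** Proper prefixes only: a hit is a moment at which some letter of u is still
    to be read. *)
Definition hits h u : nat := count (fun j => h (take j u)) (iota 0 (size u)).

Lemma hits_rcons h u x : hits h (rcons u x) = (hits h u + h u)%N.
Proof.
rewrite /hits size_rcons -addn1 iotaD count_cat /= add0n addn0.
rewrite -{2}cats1 take_size_cat//; congr addn.
apply: eq_in_count => j; rewrite mem_iota /= => ju.
by rewrite -cats1 takel_cat// ltnW.
Qed.

End Counting.

(** * The pointwise ergodic theorem for occurrences of words *)
Section Lindley.
Context (A : countType) (R : realType) (h : pred (seq A)) (al : R).
Implicit Types (u : seq A) (x : A) (j : nat).

(** The recursion of Lindley for the waiting time in a queue. Unfolded, it is
    the largest of 0 and the sums of h - al over the final stretches of the
    word, that is, the running maximum of the ergodic sums taken backward in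
    time. As a recursion it is easy to follow when the word grows at either
    end. *)
Fixpoint lindley_at u j : R :=
  if j is i.+1 then Num.max 0 (lindley_at u i + (h (take i u))%:R - al) else 0.

Definition lindley u := lindley_at u (size u).

Lemma lindley_ge0 u : 0 <= lindley u.
Proof. by rewrite /lindley; case: (size u) => //= j; rewrite le_max lexx. Qed.

Lemma lindley_rcons u x :
  lindley (rcons u x) = Num.max 0 (lindley u + (h u)%:R - al).
Proof.
rewrite /lindley size_rcons /= -{2}cats1 take_size_cat//.
have H j : (j <= size u)%N -> lindley_at (rcons u x) j = lindley_at u j.
  elim: j => // j IH ju; rewrite /= IH; last exact: ltnW.
  by rewrite -cats1 takel_cat// ltnW.
by rewrite (H _ (leqnn _)).
Qed.

(** The recursion is monotone in its state, and the state reached after one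
    extra initial letter is at least the starting value 0. *)
Lemma lindley_cons u x : (forall v, h v -> h (x :: v)) ->
  lindley u <= lindley (x :: u).
Proof.
move=> hx; rewrite /lindley [size (_ :: _)]/=.
elim: (size u) => [|j IH]; first by rewrite /= le_max lexx.
rewrite [lindley_at u _]/= [lindley_at (x :: u) _]/=.
rewrite ge_max le_max lexx /= le_max; apply/orP; right.
rewrite lerD2r lerD// ler_nat.
by have := hx (take j u); case: (h (take j u)) => // ->.
Qed.

Lemma lindley_le_size u : 0 <= al -> lindley u <= (size u)%:R.
Proof.
move=> al0; elim/last_ind: u => [|u x IH]; first by rewrite /lindley.
rewrite lindley_rcons size_rcons ge_max ler0n /= -natr1.
by case: (h u); move: IH => /=; lra.
Qed.

Lemma hits_le_lindley u : (hits h u)%:R - al * (size u)%:R <= lindley u.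
Proof.
elim/last_ind: u => [|u x IH]; first by rewrite /lindley /= mulr0 subr0.
rewrite lindley_rcons hits_rcons size_rcons natrD -natr1 mulrDr mulr1.
by rewrite le_max; apply/orP; right; move: IH; lra.
Qed.

End Lindley.

Section Ergodic.
Context (d : measure_display) (T : measurableType d) (R : realType)
  (P : probability T R) (A : countType) (X : int -> T -> A).
Hypothesis hX : random_process X.
Implicit Types (t : int) (L : nat) (u s w : seq A) (B : set (seq A)).

Local Notation pastX t L := (fun omega => past (sample_path X omega) t%R L).
Local Notation q := (prob_word P X).

Lemma integral_past_pred t L (b : pred (seq A)) :
  (\int[P]_omega ((b (pastX t L omega))%:R)%:E =
   P [set omega | b (pastX t L omega)])%E.
Proof.
have mb : measurable [set omega | b (pastX t L omega)].
  exact: (measurable_past hX t L [set u | b u]).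
rewrite -[X in _ = P X]setIT -integral_indic//; apply: eq_integral => omega _.
rewrite indicE; congr (_%:R%:E); apply/esym.
by case: (boolP (b _)) => bo; [rewrite mem_set|rewrite memNset//; exact/negP].
Qed.

Hypothesis hstat : stationary P X.
Variables (h : pred (seq A)) (al e : R).
Hypotheses (al_gt0 : 0 < al) (h_cons : forall x v, h v -> h (x :: v))
  (prob_h : forall t L, (P [set omega | h (pastX t L omega)] <= e%:E)%E).

Local Notation M := (lindley h al).

(** The maximal inequality of Hopf. If M' is the value of the recursion after
    one more letter, then M' + al * [M' > 0] <= M + h in every case. Taking
    expectations, E M <= E M', because by stationarity the extra letter may as
    well be added on the left, where it only increases M. What is left after
    cancelling the finite number E M' is al * P(M' > 0) <= E h. *)
Lemma lindley_maximal_inequality L :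
  (P [set omega | (0 < M (pastX 0 L omega))%R] <= (e / al)%:E)%E.
Proof.
have e0 : 0 <= e by rewrite -lee_fin; exact: le_trans (prob_h 0 0).
case: L => [|L].
  rewrite (_ : [set _ | _] = set0) ?measure0 ?lee_fin ?divr_ge0 ?(ltW al_gt0)//.
  by apply/seteqP; split => // omega /=; rewrite /lindley/= ltxx.
have mf t k (g : seq A -> R) := @measurable_fun_past _ _ R _ _ hX t k g.
have M0 u : (0 <= (M u)%:E)%E by rewrite lee_fin lindley_ge0.
pose E L0 t := (\int[P]_omega (M (pastX t L0 omega))%:E)%E.
have E_fin : E L.+1 0 \is a fin_num.
  rewrite ge0_fin_numE; last by apply: integral_ge0.
  apply: (@le_lt_trans _ _ (\int[P]_omega (cst (L.+1%:R)%:E omega))%E).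
    apply: ge0_le_integral => // omega _.
    by rewrite lee_fin (le_trans (lindley_le_size h _ (ltW al_gt0)))// size_past.
  by rewrite integral_cst// ltey_eq fin_numM// fin_num_measure.
pose b u : bool := 0 < M u.
have step : (E L.+1 0%R + al%:E * P [set omega | b (pastX 0 L.+1 omega)] <=
    E L.+1 0%R + P [set omega | h (pastX (-1) L omega)])%E.
  pose fb omega := ((b (pastX 0 L.+1 omega))%:R : R)%:E.
  pose fh omega := ((h (pastX (-1) L omega))%:R : R)%:E.
  have fb0 omega : setT omega -> (0 <= fb omega)%E by rewrite lee_fin.
  have fh0 omega : setT omega -> (0 <= fh omega)%E by rewrite lee_fin.
  have mfb : measurable_fun setT fb := mf 0 L.+1 (fun u => (b u)%:R).
  have mfh : measurable_fun setT fh := mf (-1) L (fun u => (h u)%:R).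
  have al_ge0 : (0 <= al%:E)%E by rewrite lee_fin ltW.
  have alfb0 omega : setT omega -> (0 <= al%:E * fb omega)%E.
    by move=> _; rewrite mule_ge0// fb0.
  have malfb : measurable_fun setT (fun omega => al%:E * fb omega)%E.
    exact: (mf 0 L.+1 (fun u => al * (b u)%:R)).
  rewrite -!integral_past_pred -/fb -/fh -(ge0_integralZl P measurableT mfb)//.
  rewrite -(ge0_integralD P measurableT _ _ alfb0 malfb)//.
  apply: (@le_trans _ _ (E L (-1)%R + \int[P]_omega fh omega)%E).
    rewrite -(ge0_integralD P measurableT _ _ fh0 mfh)//.
    apply: ge0_le_integral => //.
    - by move=> omega _; rewrite adde_ge0// alfb0.
    - exact: (mf 0 L.+1 (fun u => M u + al * (b u)%:R)).
    - exact: (mf (-1) L (fun u => M u + (h u)%:R)).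
    move=> omega _; rewrite /fb /fh -EFinM -!EFinD lee_fin /b.
    rewrite (_ : pastX 0 L.+1 omega = rcons (pastX (-1) L omega) (X 0 omega)).
      rewrite lindley_rcons.
      have := lindley_ge0 h al (pastX (-1) L omega).
      set m := M _; set hh := (h _)%:R; have hh0 : 0 <= hh by rewrite ler0n.
      by case: (leP 0 (m + hh - al)) => c m0 /=; case: ltP => /= ?; lra.
    exact: (pastS (sample_path X omega) (-1)).
  rewrite leeD2r// /E (integral_past_shift hX hstat (-1) 0); last first.
    by move=> u; exact: lindley_ge0.
  apply: ge0_le_integral => //.
  move=> omega _; rewrite lee_fin pastS_cons; apply: lindley_cons => v.
  exact: h_cons.
rewrite leeD2lE// in step.
rewrite EFinM muleC lee_pdivlMl//.
exact: (le_trans step).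
Qed.

(** Needed on the sample space and also, for the coordinate process, on the
    space of paths, where the invariant events live. *)
Lemma measurable_lindley_unbounded :
  measurable [set omega | forall k : nat, exists L, k%:R < M (pastX 0 L omega)].
Proof.
rewrite (_ : [set _ | _] = \bigcap_(k : nat) \bigcup_L
    [set omega | k%:R < M (pastX 0 L omega)]); last first.
  apply/seteqP; split => omega /=.
    by move=> H k _; have [L kL] := H k; exists L.
  by move=> H k; have [L _ kL] := H k I; exists L.
apply: bigcapT_measurable => k; apply: bigcupT_measurable => L.
exact: (measurable_past hX 0 L [set u | k%:R < M u]).
Qed.

End Ergodic.

Section AlmostSure.
Context (d : measure_display) (T : measurableType d) (R : realType)
  (P : {measure set T -> \bar R}) (I : countType).

Lemma ae_forall_countable (Q : I -> T -> Prop) :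
  (forall i, {ae P, forall omega, Q i omega}) ->
  {ae P, forall omega, forall i, Q i omega}.
Proof.
move=> H; pose F n := oapp (fun i => ~` [set omega | Q i omega]) set0
  (@pickle_inv I n).
apply: (@negligibleS _ _ _ _ (\bigcup_n F n)); last first.
  apply: negligible_bigcup => n; rewrite /F.
  by case: (pickle_inv n) => [i|] /=; [exact: H|exact: negligible_set0].
move=> omega /= /existsNP[i nQ]; exists (pickle i) => //.
by rewrite /F pickleK_inv.
Qed.

End AlmostSure.

Section ErgodicTheorem.
Context (d : measure_display) (T : measurableType d) (R : realType)
  (P : probability T R) (A : countType) (X : int -> T -> A).
Hypotheses (hX : random_process X) (hstat : stationary P X)
  (herg : ergodic P X).
Implicit Types (t : int) (L : nat) (u s w : seq A) (h : pred (seq A)).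

Local Notation pastX t L := (fun omega => past (sample_path X omega) t%R L).
Local Notation q := (prob_word P X).

(** Shifting the path performs one step of the recursion, which moves its value
    by a bounded amount, so unboundedness is a shift invariant event. It has
    probability at most e / al < 1 by the maximal inequality, hence 0 by
    ergodicity. *)
Lemma lindley_bounded h (al e : R) : 0 < al -> e < al ->
  (forall x v, h v -> h (x :: v)) ->
  (forall t L, (P [set omega | h (pastX t L omega)] <= e%:E)%E) ->
  {ae P, forall omega, exists k : nat, forall L,
    lindley h al (pastX 0 L omega) <= k%:R}.
Proof.
move=> al0 eal hc hP.
pose C : set (int -> A) :=
  [set x | forall k : nat, exists L, k%:R < lindley h al (past x 0 L)].
have mC := measurable_lindley_unbounded hX h al.
suff C0 : P (sample_path X @^-1` C) = 0%E.
  apply: (@negligibleS _ _ _ _ (sample_path X @^-1` C)); last exact/negligibleP.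
  move=> omega /= H k; apply: contrapT => nk; apply: H; exists k => L.
  by rewrite leNgt; apply/negP => kL; apply: nk; exists L.
have invC : @Defs.shift A @^-1` C = C.
  apply/seteqP; split => x /= Cx k.
    have [[|L]] := Cx k.+1; first by rewrite /lindley /= ltrn0.
    rewrite past_shift pastS lindley_rcons lt_max ltrn0 /= => kL.
    exists L; move: kL; rewrite -natr1; case: (h _) => /=; lra.
  have [L] := Cx (k + Num.bound al)%N.
  have := archi_boundP (ltW al0).
  move=> Hb kL; exists L.+1; rewrite past_shift pastS lindley_rcons lt_max.
  apply/orP; right; move: kL; rewrite natrD.
  by case: (h _) => /=; lra.
(* A measurable type must have a point, and any constant path will do. *)
have gC : <<s @coord_events A >> C.
  pose PT : pointedType := HB.pack (int -> A)
    (gen_eqMixin (int -> A)) (gen_choiceMixin (int -> A))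
    (isPointed.Build (int -> A) (fun=> X 0 point)).
  apply: (@measurable_lindley_unbounded _
    (@g_sigma_algebraType PT (@coord_events A)) R A (fun t x => x t)).
  by move=> t a; apply: sub_sigma_algebra; exists t, a.
have [//|C1] := herg gC invC.
suff : (P (sample_path X @^-1` C) <= (e / al)%:E)%E.
  by rewrite C1 lee_fin ler_pdivlMr// mul1r leNgt eal.
pose S L := [set omega | (0 < lindley h al (pastX 0 L omega))%R].
have mS L : measurable (S L).
  exact: (measurable_past hX 0 L [set u | 0 < lindley h al u]).
have mUS : measurable (\bigcup_L S L) by exact: bigcupT_measurable.
apply: (@le_trans _ _ (P (\bigcup_L S L))).
  by apply: le_measure; rewrite ?inE// => omega /(_ 0%N)[L L0]; exists L.
have cv := nondecreasing_cvg_mu (mu := P) mS mUS.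
have {}cv : (P \o S) x @[x --> \oo] --> P (\bigcup_n S n).
  apply: cv => m n mn; apply/subsetPset => omega; rewrite /S /=.
  move=> /lt_le_trans; apply; move: n mn.
  elim=> [|n IH]; first by rewrite leqn0 => /eqP ->.
  rewrite leq_eqVlt ltnS => /orP[/eqP -> //|/IH /le_trans]; apply.
  by rewrite pastS_cons; apply: lindley_cons => v; exact: hc.
rewrite -(cvg_lim (@ereal_hausdorff R) cv).
apply: lime_le; first by apply/cvg_ex; eexists; exact: cv.
by apply: nearW => L; exact: (lindley_maximal_inequality hX hstat al0 hc hP L).
Qed.

Lemma prob_suffix_le s t L :
  (P [set omega | suffix s (pastX t L omega)] <= (q s)%:E)%E.
Proof.
have [sL|Ls] := leqP (size s) L.
  rewrite -(prob_past hX hstat t) le_measure ?inE//.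
  - exact: (measurable_past hX t L [set u | suffix s u]).
  - exact: measurable_past_eq.
  - by move=> omega /=; rewrite suffix_past// => /eqP.
rewrite (_ : [set _ | _] = set0) ?measure0 ?lee_fin ?prob_word_ge0//.
apply/seteqP; split => // omega /= /size_suffix.
by rewrite size_past leqNgt Ls.
Qed.

Lemma prob_word_le1 u : q u <= 1.
Proof.
rewrite -lee_fin -(prob_past hX hstat 0) probability_le1//.
exact: measurable_past_eq.
Qed.

Lemma prob_nsuffix_le s t L :
  (P [set omega | (size s <= size (pastX t L omega))%N &&
      ~~ suffix s (pastX t L omega)] <= (1 - q s)%:E)%E.
Proof.
have [sL|Ls] := leqP (size s) L.
  rewrite EFinB -(prob_past hX hstat t) -probability_setC; last exact: measurable_past_eq.
  rewrite le_measure ?inE//.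
  - exact: (measurable_past hX t L [set u | (size s <= size u)%N && ~~ suffix s u]).
  - by apply: measurableC; exact: measurable_past_eq.
  - by move=> omega /=; rewrite suffix_past// => /andP[_ /eqP].
rewrite (_ : [set _ | _] = set0) ?measure0 ?lee_fin ?subr_ge0 ?prob_word_le1//.
by apply/seteqP; split => // omega /=; rewrite size_past leqNgt Ls.
Qed.

(** Lower bounds for the occurrences of s are upper bounds for the complementary
    predicate. The complement is taken among the words that are long enough to
    contain s: this keeps it stable under adding a letter on the left. *)
Lemma hits_nsuffix s u : (size u <= hits (suffix s) u +
  hits (fun v => (size s <= size v)%N && ~~ suffix s v) u + size s)%N.
Proof.
elim/last_ind: u => // u x IH; rewrite !hits_rcons size_rcons.
have [us|su] := ltnP (size u) (size s); first by rewrite (leq_trans us)// leq_addl.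
by case: (suffix s u) => /=; lia.
Qed.

Lemma hits_suffix_dev s (c : R) : 0 < c ->
  {ae P, forall omega, exists k : nat, forall L,
    `|(hits (suffix s) (pastX 0 L omega))%:R - q s * L%:R| <= c * L%:R + k%:R}.
Proof.
move=> c0; pose h u := (size s <= size u)%N && ~~ suffix s u.
have q0 := prob_word_ge0 P X s; have q1 := prob_word_le1 s.
have H1 : {ae P, forall omega, exists k : nat, forall L,
    lindley (suffix s) (q s + c) (pastX 0 L omega) <= k%:R}.
  apply: (@lindley_bounded _ _ (q s)); [lra|lra| |exact: prob_suffix_le].
  by move=> x v; rewrite -cat1s; exact: suffix_catr.
have H2 : {ae P, forall omega, exists k : nat, forall L,
    lindley h (1 - q s + c) (pastX 0 L omega) <= k%:R}.
  apply: (@lindley_bounded _ _ (1 - q s)); [lra|lra| |exact: prob_nsuffix_le].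
  move=> x v /andP[sv nsv]; rewrite /h /= (leqW sv) /=.
  by apply: contra nsv; rewrite !suffixE /= subSn.
apply: filterS2 H1 H2 => omega [k1 h1] [k2 h2].
exists (k1 + k2 + size s)%N => L.
have := h1 L; have := h2 L; have := hits_nsuffix s (pastX 0 L omega).
have := hits_le_lindley (suffix s) (q s + c) (pastX 0 L omega).
have := hits_le_lindley h (1 - q s + c) (pastX 0 L omega).
rewrite !size_past -/h; set a := hits _ _; set b := hits _ _.
rewrite -(ler_nat R) !natrD.
set l1 := lindley _ _ _; set l2 := lindley _ _ _.
have := ler0n R (size s); have := ler0n R k1; have := ler0n R k2.
move: (k1%:R) (k2%:R) ((size s)%:R) (L%:R) (a%:R) (b%:R) => K1 K2 S L' a' b'.
rewrite !mulrDl mulNr !mul1r.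
rewrite ler_norml; move: (c * L') (q s * L') => cL qL *.
by apply/andP; split; lra.
Qed.

(** The pointwise ergodic theorem for the indicators of words, backward in
    time. *)
Lemma hits_suffix_cvg :
  {ae P, forall omega, forall s,
    (hits (suffix s) (pastX 0 L omega))%:R / L%:R @[L --> \oo] --> q s}.
Proof.
have HQ s (m : nat) : {ae P, forall omega, exists k : nat, forall L,
    `|(hits (suffix s) (pastX 0 L omega))%:R - q s * L%:R| <=
    m.+1%:R^-1 * L%:R + k%:R}.
  by apply: hits_suffix_dev; rewrite invr_gt0.
have := ae_forall_countable (fun s => ae_forall_countable (HQ s)).
apply: filterS => omega HH s; apply/cvgrPdist_le => eps eps0.
have [m mE] : exists m : nat, m.+1%:R^-1 <= eps / 2.
  exists (Num.bound (eps / 2)^-1).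
  rewrite -[leRHS]invrK lef_pV2 ?posrE ?invr_gt0 ?divr_gt0//.
  have : 0 <= (eps / 2)^-1 by rewrite invr_ge0 divr_ge0 ?ltW.
  by move=> /archi_boundP /ltW /le_trans; apply; rewrite ler_nat.
have [k Hk] := HH s m.
near=> L.
have L0 : 0 < L%:R :> R by rewrite ltr0n; near: L; exists 1%N.
have kL : k%:R <= eps / 2 * L%:R.
  have eps2 : 0 < eps / 2 by rewrite divr_gt0.
  have : (Num.bound (k%:R / (eps / 2)) <= L)%N by near: L; exact: nbhs_infty_ge.
  rewrite -(ler_nat R) [eps / 2 * _]mulrC -ler_pdivrMr//; apply: le_trans; apply: ltW.
  by apply: archi_boundP; rewrite divr_ge0// ltW.
rewrite distrC.
rewrite -[q s](mulfK (lt0r_neq0 L0)) -mulrBl normrM normfV (gtr0_norm L0).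
rewrite ler_pdivrMr//; apply: (le_trans (Hk L)).
have mL : m.+1%:R^-1 * L%:R <= eps / 2 * L%:R by rewrite ler_wpM2r// ltW.
by rewrite (le_trans (lerD mL kL))// -mulrDl -splitr.
Unshelve. all: by end_near. Qed.

End ErgodicTheorem.

(** * Gambling against a memory word *)
Section Gambling.
Context (A : countType).
Implicit Types (rho : pred (seq A)) (u : seq A) (x y : A).

(** The predicate rho is a selection rule: it decides from the letters read so
    far whether to bet on the next letter being y. Its bets are the hits, and
    the gains are the bets won. *)
Definition gains rho y u : nat :=
  count (fun j => rho (take j u) && (onth u j == Some y)) (iota 0 (size u)).

Lemma gains_rcons rho y u x :
  gains rho y (rcons u x) = (gains rho y u + (rho u && (x == y)))%N.
Proof.
rewrite /gains size_rcons -addn1 iotaD count_cat /= add0n addn0.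
rewrite -{3 4}cats1 take_size_cat// onth_cat ltnn subnn /=; congr addn.
apply: eq_in_count => j; rewrite mem_iota /= => ju.
by rewrite -cats1 takel_cat ?(ltnW ju)// onth_cat ju.
Qed.

Lemma gains_le_hits rho y u : (gains rho y u <= hits rho u)%N.
Proof. by apply: sub_count => j /andP[]. Qed.

End Gambling.

(** From exp (- x) >= 1 - x, since (1 - x) * (1 + x + 2 x^2) >= 1 when
    x <= 1/2. *)
Lemma expR_quadratic (R : realType) (x : R) :
  x <= 2^-1 -> expR x <= 1 + x + 2 * x ^+ 2.
Proof.
move=> x2; have x1 : 0 < 1 - x by lra.
have : 1 - x <= expR (- x) by have := @expR_ge1Dx R (- x); lra.
rewrite expRN -[leRHS]invrK => H.
have {}H : expR x <= (1 - x)^-1.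
  by rewrite -(invrK (expR x)) lef_pV2 ?posrE ?invr_gt0 ?expR_gt0//; rewrite invrK in H.
apply: (le_trans H); rewrite -[leLHS]mul1r ler_pdivrMr//.
have : 0 <= x ^+ 2 * (1 - 2 * x) by rewrite mulr_ge0 ?sqr_ge0//; lra.
nra.
Qed.

(** The exponential moment of a centred two-point variable: the linear terms of
    the quadratic bound cancel and leave at most 1 + 2 lam^2. *)
Lemma hoeffding_two_point (R : realType) (p lam : R) :
  0 <= p <= 1 -> `|lam| <= 2^-1 ->
  p * expR (lam * (1 - p) - 2 * lam ^+ 2) +
  (1 - p) * expR (- (lam * p) - 2 * lam ^+ 2) <= 1.
Proof.
move=> /andP[p0 p1]; rewrite ler_norml => /andP[l1 l2].
have e1 := @expR_quadratic R (lam * (1 - p)).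
have e2 := @expR_quadratic R (- (lam * p)).
have {}e1 : expR (lam * (1 - p)) <= 1 + lam * (1 - p) + 2 * (lam * (1 - p)) ^+ 2.
  by apply: e1; nra.
have {}e2 : expR (- (lam * p)) <= 1 + - (lam * p) + 2 * (- (lam * p)) ^+ 2.
  by apply: e2; nra.
have e3 := @expR_ge1Dx R (2 * lam ^+ 2).
rewrite !expRD (expRN (2 * _)) !(mulrA _ _ (_^-1)) -mulrDl.
rewrite ler_pdivrMr ?expR_gt0// mul1r; apply: (le_trans _ e3).
apply: (@le_trans _ _ (p * (1 + lam * (1 - p) + 2 * (lam * (1 - p)) ^+ 2) +
  (1 - p) * (1 + - (lam * p) + 2 * (- (lam * p)) ^+ 2))).
  by rewrite lerD// ler_wpM2l//; lra.
have : 0 <= lam ^+ 2 * (1 - p * (1 - p)).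
  by rewrite mulr_ge0 ?sqr_ge0//; nra.
nra.
Qed.

Section MemoryWords.
Context (d : measure_display) (T : measurableType d) (R : realType)
  (P : probability T R) (A : countType) (X : int -> T -> A).
Hypotheses (hX : random_process X) (hstat : stationary P X).
Implicit Types (t : int) (L : nat) (u s w : seq A) (rho : pred (seq A)).

Local Notation pastX t L := (fun omega => past (sample_path X omega) t%R L).
Local Notation q := (prob_word P X).

Lemma past_rconsE t u y :
  pastX t (size u) @^-1` [set u] `&` X (t + 1) @^-1` [set y] =
  pastX (t + 1) (size (rcons u y)) @^-1` [set rcons u y].
Proof.
rewrite size_rcons; apply/seteqP; split => omega /=; rewrite pastS.
  by move=> [-> <-].
by move/rcons_inj => [].
Qed.

Lemma prob_rcons t u y :
  P (pastX t (size u) @^-1` [set u] `&` X (t + 1) @^-1` [set y]) =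
  (q (rcons u y))%:E.
Proof. by rewrite past_rconsE prob_past. Qed.

Lemma prob_word_rcons_le u y : q (rcons u y) <= q u.
Proof.
rewrite -lee_fin -(prob_rcons 0) -(prob_past hX hstat 0) le_measure ?inE//.
- by apply: measurableI; [exact: measurable_past_eq|exact: hX].
- exact: measurable_past_eq.
Qed.

Lemma prob_word_suffix_le w u : suffix w u -> q u <= q w.
Proof.
move=> wu; rewrite -lee_fin -(prob_past hX hstat 0 u).
rewrite (le_trans _ (prob_suffix_le hX hstat w 0 (size u)))// le_measure ?inE//.
- exact: measurable_past_eq.
- exact: (measurable_past hX 0 (size u) [set v | suffix w v]).
- by move=> omega /= ->.
Qed.

Lemma cond_probE y w : cond_prob P X y w = q (rcons w y) / q w.
Proof.
rewrite /cond_prob; congr (_ / _).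
have h0 : 0 - (1 - (size w)%:Z) + 1 = (size w)%:Z by lia.
rewrite -[RHS]/(fine (q (rcons w y))%:E) -(prob_rcons 0); congr (fine (P _)).
by apply/seteqP; split => omega /=; rewrite (seg_past _ h0) add0r.
Qed.

Lemma cond_prob_ge0 y w : 0 <= cond_prob P X y w.
Proof. by rewrite cond_probE divr_ge0 ?prob_word_ge0. Qed.

Lemma cond_prob_le1 y w : cond_prob P X y w <= 1.
Proof.
rewrite cond_probE; have := prob_word_ge0 P X w; rewrite le_eqVlt => /orP[/eqP <-|w0].
  by rewrite invr0 mulr0.
by rewrite ler_pdivrMr// mul1r prob_word_rcons_le.
Qed.

Variable w : seq A.
Hypothesis hw : memory_word P X w.
Local Notation p y := (cond_prob P X y w).

(** The definition of a memory word equates conditional probabilities only for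
    words that can occur. The inequality survives without this condition, and a
    supermartingale needs no more. *)
Lemma memory_word_rcons u y : suffix w u -> q (rcons u y) <= p y * q u.
Proof.
move=> /suffixP[z uE]; have := prob_word_ge0 P X (rcons u y).
rewrite le_eqVlt => /orP[/eqP <-|uy0].
  by rewrite mulr_ge0 ?cond_prob_ge0 ?prob_word_ge0.
have u0 : 0 < q u by exact: lt_le_trans (prob_word_rcons_le u y).
have -> : p y = cond_prob P X y u.
  rewrite uE; case: z uE => // a z uE.
  by apply: (hw (i := (size z).+1)) => //; rewrite -rcons_cat -uE.
by rewrite cond_probE divfK// gt_eqF.
Qed.

(** The complementary bound does not follow from the previous one by taking
    complements; it is the sum of that bound over all letters other than y. *)
Lemma memory_word_rcons_neq t u y : suffix w u ->
  (P (pastX t (size u) @^-1` [set u] `&` ~` (X (t + 1) @^-1` [set y])) <=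
   ((1 - p y) * q u)%:E)%E.
Proof.
move=> wu.
have mE v : measurable (pastX t (size v) @^-1` [set v]) by exact: measurable_past_eq.
have mXy y' : measurable (X (t + 1) @^-1` [set y']) by exact: hX.
have := prob_word_ge0 P X w; rewrite le_eqVlt => /orP[/eqP w0|w0].
  have u0 : q u = 0.
    by apply/eqP; rewrite eq_le prob_word_ge0 andbT w0 prob_word_suffix_le.
  rewrite u0 mulr0 -u0 -(prob_past hX hstat t) le_measure ?inE//.
  by apply: measurableI => //; exact: measurableC.
pose F v y' := if y' == y then set0 else
  pastX t (size v) @^-1` [set v] `&` X (t + 1) @^-1` [set y'].
have mF v y' : measurable (F v y').
  by rewrite /F; case: eqP => // _; exact: measurableI.
have FE v : pastX t (size v) @^-1` [set v] `&` ~` (X (t + 1) @^-1` [set y]) =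
    \bigcup_y' F v y'.
  apply/seteqP; split => omega /=.
    move=> [ov oy]; exists (X (t + 1) omega) => //; rewrite /F.
    by case: eqP.
  move=> [y' _]; rewrite /F; case: eqP => //= yy [-> ->]; split => //.
have c0 : 0 <= q u / q w by rewrite divr_ge0 ?prob_word_ge0.
have tF : trivIset setT (F w).
  move=> y1 y2 _ _ [omega []]; rewrite /F.
  by case: eqP => //= _ [_ <-]; case: eqP => //= _ [_ <-].
have FG y' : (P (F u y') <= (q u / q w)%:E * P (F w y'))%E.
  rewrite /F; case: eqP => /= _; first by rewrite !measure0 mule0.
  rewrite !prob_rcons -EFinM lee_fin (le_trans (memory_word_rcons y' wu))//.
  by rewrite cond_probE [leLHS]mulrC mulrA mulrAC.
have : (P (\bigcup_y' F u y') <= (q u / q w)%:E * P (\bigcup_y' F w y'))%E.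
  exact: measure_le_countable.
rewrite -!FE => /le_trans; apply; rewrite -setDE.
have -> : P (pastX t (size w) @^-1` [set w] `\` X (t + 1) @^-1` [set y]) =
    (P (pastX t (size w) @^-1` [set w]) - P (pastX t (size w) @^-1` [set w] `&`
      X (t + 1) @^-1` [set y]))%E.
  by rewrite measureD// ltey_eq fin_num_measure.
rewrite prob_rcons prob_past// -EFinB -EFinM lee_fin cond_probE.
rewrite mulrBr mulrBl mul1r divfK ?gt_eqF// lerD2l lerN2.
by rewrite [leLHS]mulrC mulrA mulrAC.
Qed.

End MemoryWords.

Section Wealth.
Context (d : measure_display) (T : measurableType d) (R : realType)
  (P : probability T R) (A : countType) (X : int -> T -> A).
Hypotheses (hX : random_process X) (hstat : stationary P X).
Variable w : seq A.
Hypothesis hw : memory_word P X w.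
Implicit Types (t : int) (L : nat) (u s : seq A) (rho : pred (seq A)).

Local Notation pastX t L := (fun omega => past (sample_path X omega) t%R L).
Local Notation q := (prob_word P X).
Local Notation p y := (cond_prob P X y w).

Lemma integral_le_cst (D : set T) (f : T -> \bar R) (a : R) :
  measurable D -> measurable_fun setT f -> (forall omega, (0 <= f omega)%E) ->
  (forall omega, D omega -> (f omega <= a%:E)%E) ->
  (\int[P]_(omega in D) f omega <= a%:E * P D)%E.
Proof.
move=> mD mf f0 fa; rewrite -integral_cst//; apply: ge0_le_integral => //.
exact: measurable_funS mf.
Qed.

(** One step in time for functionals of the window. When the word seen is u and
    ends in w, the next letter is y with probability at most p y and different
    from y with probability at most 1 - p y, and it suffices that V' u dominates
    the corresponding average of V. In general V' u has to dominate V whatever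
    letter comes. *)
Lemma prediction_step y (V V' : seq A -> R) t L :
  (forall u, 0 <= V u) -> (forall u, 0 <= V' u) ->
  (forall u, (forall x, V (rcons u x) <= V' u) \/
    suffix w u /\ exists a b, [/\ 0 <= a, 0 <= b, V (rcons u y) <= a,
      forall x, x != y -> V (rcons u x) <= b & p y * a + (1 - p y) * b <= V' u]) ->
  (\int[P]_omega (V (pastX (t + 1) L.+1 omega))%:E <=
   \int[P]_omega (V' (pastX t L omega))%:E)%E.
Proof.
move=> V0 V'0 H.
pose F u := pastX t L @^-1` [set u].
have mF u : measurable (F u) by exact: measurable_past_eq.
have mV : measurable_fun setT (fun omega => (V (pastX (t + 1) L.+1 omega))%:E).
  exact: (measurable_fun_past hX (t + 1) L.+1 V).
have mV' : measurable_fun setT (fun omega => (V' (pastX t L omega))%:E).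
  exact: (measurable_fun_past hX t L V').
apply: (@le_integral_countable _ _ _ _ _ F F) => //.
- exact: trivIset_past.
- exact: trivIset_past.
- exact: bigcup_past.
- exact: bigcup_past.
- by move=> omega; rewrite lee_fin.
- by move=> omega; rewrite lee_fin.
move=> u; have [Lu|Lu] := eqVneq L (size u); last first.
  rewrite (_ : F u = set0) ?integral_set0//.
  apply/seteqP; split => // omega /= pu; move/negP: Lu; apply.
  by rewrite -pu size_past.
have [Hle|[wu [a [b [a0 b0 Va Vb ab]]]]] := H u.
  apply: ge0_le_integral => //.
  - by move=> omega _; rewrite lee_fin.
  - exact: measurable_funS mV.
  - exact: measurable_funS mV'.
  by move=> omega; rewrite /F /= => pu; rewrite pastS pu lee_fin.
have -> : (\int[P]_(omega in F u) (V' (pastX t L omega))%:E = (V' u * q u)%:E)%E.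
  rewrite EFinM -(prob_past hX hstat t u) -Lu -(integral_cst P (mF u)).
  by apply: eq_integral => omega; rewrite inE /F /= => ->.
pose Y := X (t + 1) @^-1` [set y].
have mY : measurable Y by exact: hX.
have -> : F u = (F u `&` Y) `|` (F u `&` ~` Y) by rewrite -setIUr setUv setIT.
have mFY : measurable (F u `&` Y) by exact: measurableI.
have mFnY : measurable (F u `&` ~` Y).
  by apply: measurableI => //; exact: measurableC.
rewrite ge0_integral_setU//; last 3 first.
- by apply: (measurable_funS measurableT) => //.
- by move=> omega _; rewrite lee_fin.
- by rewrite disj_set2E setIACA setICr setI0.
have e1 : (\int[P]_(omega in F u `&` Y) (V (pastX (t + 1) L.+1 omega))%:E <=
    (a * (p y * q u))%:E)%E.
  apply: (@le_trans _ _ (a%:E * P (F u `&` Y))%E).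
    apply: integral_le_cst => // [omega|omega [+ +]]; rewrite lee_fin//.
    by rewrite /F /Y /= => pu xy; rewrite pastS pu /sample_path xy.
  rewrite EFinM lee_wpmul2l ?lee_fin// /F Lu /Y (prob_rcons hX hstat) lee_fin.
  exact: memory_word_rcons.
have e2 : (\int[P]_(omega in F u `&` ~` Y) (V (pastX (t + 1) L.+1 omega))%:E <=
    (b * ((1 - p y) * q u))%:E)%E.
  apply: (@le_trans _ _ (b%:E * P (F u `&` ~` Y))%E).
    apply: integral_le_cst => // [omega|omega [+ +]]; rewrite lee_fin//.
    rewrite /F /Y /= => pu /eqP xy; rewrite pastS pu.
    exact: Vb.
  rewrite EFinM lee_wpmul2l ?lee_fin// /F Lu /Y.
  exact: memory_word_rcons_neq.
apply: (le_trans (leeD e1 e2)); rewrite -EFinD lee_fin.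
have : 0 <= q u * (V' u - (p y * a + (1 - p y) * b)).
  by rewrite mulr_ge0 ?prob_word_ge0 ?subr_ge0.
by set c := p y; nra.
Qed.

Variables (y : A) (rho : pred (seq A)) (lam : R).
Hypotheses (rho_w : forall u, rho u -> suffix w u) (hlam : `|lam| <= 2^-1).

(** The exponential of the surplus is the wealth of a gambler who stakes along
    the rule rho at the odds p y; the quadratic term makes it a
    supermartingale. *)
Definition surplus u : R :=
  lam * ((gains rho y u)%:R - p y * (hits rho u)%:R) -
  2 * lam ^+ 2 * (hits rho u)%:R.

(** The factor p y on the right is what makes the estimate summable over an
    infinite alphabet. It comes from weighting the wealth by the number of
    gains: a gain has probability p y, and multiplies the wealth by at
    most 2. The constant K carries the induction, which moves each possible
    gain of the last letter into it. *)
Lemma gains_wealth_bound (K : R) t L : 0 <= K ->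
  (\int[P]_omega (((gains rho y (pastX t L omega))%:R + K) *
     expR (surplus (pastX t L omega)))%:E <= (K + 2 * p y * L%:R)%:E)%E.
Proof.
elim: L t K => [|L IH] t K K0.
  rewrite mulr0 addr0 (le_trans (integral_le_cst (a := K) _ _ _ _))//.
  - exact: (measurable_fun_past hX t 0
      (fun u => ((gains rho y u)%:R + K) * expR (surplus u))).
  - by move=> omega; rewrite lee_fin mulr_ge0 ?expR_ge0// addr_ge0.
  - move=> omega _; rewrite lee_fin /surplus /gains /hits /=.
    by rewrite !mulr0 !subr0 mulr0 expR0 mulr1 add0r.
  - rewrite -[leRHS]mule1 lee_wpmul2l ?lee_fin//; exact: probability_le1.
have p0 := cond_prob_ge0 hX hstat y w.
have p1 := cond_prob_le1 hX hstat y w.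
have K'0 : 0 <= K + 2 * p y by rewrite addr_ge0// mulr_ge0.
have -> : K + 2 * p y * L.+1%:R = K + 2 * p y + 2 * p y * L%:R.
  by rewrite -[L.+1]addn1 natrD; ring.
apply: le_trans (IH (t - 1) (K + 2 * p y) K'0).
have -> : t = t - 1 + 1 by lia.
rewrite [t - 1 + 1 - 1](_ : _ = t - 1); last by lia.
pose V K1 u := ((gains rho y u)%:R + K1) * expR (surplus u).
have V0 K1 u : 0 <= K1 -> 0 <= V K1 u.
  by move=> K10; rewrite mulr_ge0 ?expR_ge0// addr_ge0.
apply: (@prediction_step y (V K) (V (K + 2 * p y)) (t - 1) L).
- by move=> u; exact: V0.
- by move=> u; exact: V0.
move=> u; rewrite /V; have [ru|nru] := boolP (rho u); last first.
  left=> x; rewrite /surplus gains_rcons hits_rcons (negPf nru) /= !addn0.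
  by rewrite ler_wpM2r ?expR_ge0// lerD2l lerDl mulr_ge0.
right; split; first exact: rho_w.
set g : R := (gains rho y u)%:R; set S := surplus u.
set al := expR (lam * (1 - p y) - 2 * lam ^+ 2).
set be := expR (- (lam * p y) - 2 * lam ^+ 2).
have hoef : p y * al + (1 - p y) * be <= 1.
  by apply: hoeffding_two_point => //; rewrite p0.
have al2 : al <= 2.
  have l2 : lam * (1 - p y) <= 2^-1 by move: hlam; rewrite ler_norml => /andP[]; nra.
  apply: (@le_trans _ _ (expR (lam * (1 - p y)))).
    by rewrite ler_expR lerBlDr lerDl mulr_ge0 ?sqr_ge0.
  have l1 : - 2^-1 <= lam * (1 - p y).
    by move: hlam; rewrite ler_norml => /andP[]; nra.
  apply: (le_trans (expR_quadratic l2)).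
  nra.
exists ((g + 1 + K) * (expR S * al)), ((g + K) * (expR S * be)).
have g0 : 0 <= g by rewrite /g.
have al0 : 0 < al by exact: expR_gt0.
have be0 : 0 < be by exact: expR_gt0.
have S0 : 0 < expR S by exact: expR_gt0.
split.
- by rewrite !mulr_ge0 ?addr_ge0// ltW.
- by rewrite !mulr_ge0 ?addr_ge0// ltW.
- rewrite gains_rcons ru eqxx natrD -/g ler_wpM2l ?addr_ge0//.
  rewrite -expRD ler_expR /S /surplus hits_rcons gains_rcons ru eqxx /= !natrD.
  by rewrite le_eqVlt; apply/orP; left; apply/eqP; ring.
- move=> x xy; rewrite gains_rcons ru (negPf xy) addn0 -/g ler_wpM2l ?addr_ge0//.
  rewrite -expRD ler_expR /S /surplus hits_rcons gains_rcons ru (negPf xy) /= !natrD.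
  by rewrite le_eqVlt; apply/orP; left; apply/eqP; ring.
have h1 : 0 <= (g + K) * expR S * (1 - (p y * al + (1 - p y) * be)).
  by rewrite !mulr_ge0 ?subr_ge0// ?addr_ge0// ltW.
have h2 : 0 <= p y * expR S * (2 - al).
  by apply: mulr_ge0; rewrite ?subr_ge0//; apply: mulr_ge0 => //; exact: ltW.
rewrite -subr_ge0; apply: le_trans (addr_ge0 h1 h2) _.
by rewrite le_eqVlt; apply/orP; left; apply/eqP; ring.
Qed.

(** The inequality of Markov for gains times wealth, which is at least exp xi
    on this event. *)
Lemma surplus_tail_bound (xi : R) t L :
  (P [set omega | (0 < gains rho y (pastX t L omega))%N /\
       (xi <= surplus (pastX t L omega))%R] <=
   (2 * p y * L%:R * expR (- xi))%:E)%E.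
Proof.
pose D := pastX t L @^-1` [set u | (0 < gains rho y u)%N /\ xi <= surplus u].
have mD : measurable D by exact: measurable_past.
have := gains_wealth_bound t L (lexx 0); rewrite add0r => H.
rewrite expRN EFinM muleC lee_pdivlMl ?expR_gt0//; apply: (le_trans _ H).
pose f (u : seq A) : R := ((gains rho y u)%:R + 0) * expR (surplus u).
have f0 u : 0 <= f u by rewrite mulr_ge0 ?expR_ge0// addr_ge0.
have mf : measurable_fun setT (fun omega => (f (pastX t L omega))%:E).
  exact: (measurable_fun_past hX t L f).
apply: (@le_trans _ _ (\int[P]_(omega in D) (f (pastX t L omega))%:E)%E).
  rewrite -integral_cst//; apply: ge0_le_integral => //.
  - by move=> omega _; rewrite lee_fin expR_ge0.
  - exact: measurable_funS mf.
  - move=> omega [g0 xis]; rewrite lee_fin /f addr0 -[leLHS]mul1r.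
    by rewrite ler_pM ?expR_ge0 ?ler1n ?ler_expR.
apply: ge0_subset_integral => // omega _; rewrite lee_fin//.
Qed.

End Wealth.

(** * Words with a memory suffix are eventually typical *)
Section FirstOccurrence.
Context (A : countType) (w : seq A).
Implicit Types (u v s : seq A) (y : A).

(** Bet at every recurrence of the word seen at the places a, ..., b - 1. The
    word is random, but the rule that waits for it is one of polynomially many,
    and it never looks at letters still to come. *)
Definition recurrence_rule (a b : nat) v : bool :=
  [&& suffix w v, (b <= size v)%N & suffix (drop a (take b v)) v].

(** Let b be the end of the first occurrence of s in u. From then on the rule
    bets exactly at the occurrences of s, and before b there are none. *)
Lemma first_occurrence s y u : suffix w s -> (0 < gains (suffix s) y u)%N ->
  exists2 ab : 'I_(size u) * 'I_(size u), 
    gains (suffix s) y u = gains (recurrence_rule ab.1 ab.2) y u &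
    hits (suffix s) u = hits (recurrence_rule ab.1 ab.2) u.
Proof.
move=> ws; rewrite -has_count => /hasP[j0]; rewrite mem_iota add0n /= => j0u.
move=> /andP[sj0 _].
have ex : exists j, (j < size u)%N && suffix s (take j u).
  by exists j0; rewrite j0u.
case: (ex_minnP ex) => b /andP[bu sb] bmin.
have sizeb : size (take b u) = b by rewrite size_takel// ltnW.
have sizes : (size s <= b)%N by rewrite -sizeb (size_suffix sb).
have au : (b - size s < size u)%N by rewrite (leq_ltn_trans _ bu)// leq_subr.
have sE : s = drop (b - size s) (take b u).
  by move: sb; rewrite suffixE sizeb => /eqP.
have ruleE j : (j < size u)%N ->
    suffix s (take j u) = recurrence_rule (b - size s) b (take j u).
  move=> ju; rewrite /recurrence_rule size_takel; last exact: ltnW.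
  have [bj|jb] := leqP b j; last first.
    rewrite andbF; apply/negP => sj.
    by have := bmin j; rewrite ju sj leqNgt jb => /(_ isT).
  rewrite take_takel// -sE /=; case: (boolP (suffix s _)) => [sj|_].
    by rewrite (suffix_trans ws sj).
  by rewrite andbF.
exists (Ordinal au, Ordinal bu) => /=.
  by apply: eq_in_count => j; rewrite mem_iota add0n /= => ju; rewrite ruleE.
by apply: eq_in_count => j; rewrite mem_iota add0n /= => ju; rewrite ruleE.
Qed.

End FirstOccurrence.

Lemma finite_union_bound (d : measure_display) (T : measurableType d)
  (R : realType) (P : probability T R) (I : finType) (E : I -> set T) (c : R) :
  (forall i, measurable (E i)) -> (forall i, (P (E i) <= c%:E)%E) ->
  (P (\bigcup_i E i) <= (#|I|%:R * c)%:E)%E.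
Proof.
move=> mE Ec.
have H (r : seq I) : measurable (\bigcup_(i in [set` r]) E i) /\
    (P (\bigcup_(i in [set` r]) E i) <= ((size r)%:R * c)%:E)%E.
  elim: r => [|i r [mr IH]].
    by rewrite set_nil bigcup_set0 measure0 mul0r.
  have -> : [set` i :: r] = i |` [set` r].
    apply/seteqP; split => j /=; rewrite inE => H.
      by case/orP: H => [/eqP|]; [left|right].
    by apply/orP; case: H => [/eqP|]; [left|right].
  rewrite bigcup_setU1; split; first exact: measurableU.
  rewrite (le_trans (measureU2 _ _ _))// [size _]/= -addn1 natrD mulrDl mul1r EFinD.
  by rewrite addeC; apply: leeD; [exact: Ec|exact: IH].
have := (H (enum I)).2; rewrite -cardE (_ : [set` enum I] = setT)//.
by apply/seteqP; split => // i _ /=; rewrite mem_enum.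
Qed.

Lemma expR_ge_pow (R : realType) (x : R) (k : nat) : 0 <= x ->
  x ^+ k.+1 * expR (- x) <= k.+1`!%:R.
Proof.
move=> x0; rewrite expRN ler_pdivrMr ?expR_gt0// mulrC -ler_pdivrMr ?ltr0n ?fact_gt0//.
by have := @expR_ge1Dxn R x k x0; lra.
Qed.

(** The majorant telescopes: it is C / (n + 1) - C / (n + 2). *)
Lemma nneseries_inverse_square (R : realType) (f : nat -> R) (C : R) :
  (forall n, 0 <= f n) -> (forall n, f n <= C / (n.+1%:R * n.+2%:R)) ->
  (\sum_(n <oo) (f n)%:E < +oo)%E.
Proof.
move=> f0 fC.
have C0 : 0 <= C.
  have := le_trans (f0 0%N) (fC 0%N); rewrite pmulr_lge0//.
apply: (@le_lt_trans _ _ C%:E); last exact: ltry.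
apply: lime_le; first by apply: is_cvg_nneseries => n _ _; rewrite lee_fin.
apply: nearW => N; rewrite sumEFin lee_fin.
apply: (@le_trans _ _ (\sum_(0 <= n < N) (C * (- n.+2%:R^-1 - - n.+1%:R^-1)))).
  apply: ler_sum => n _; apply: (le_trans (fC n)).
  rewrite le_eqVlt; apply/orP; left; apply/eqP; congr (_ * _).
  have N0 : 0 < n.+1%:R :> R by [].
  rewrite opprK addrC -[n.+2]addn1 natrD; move: n.+1%:R N0 => a a0.
  by field; apply/andP; split; apply/eqP; lra.
rewrite -big_distrr /= (telescope_sumr (fun n => - n.+1%:R^-1))//.
by rewrite invr1 opprK -{2}[C]mulr1 ler_wpM2l// gerDr oppr_le0 invr_ge0.
Qed.

(** Since n is at most a fixed power of n^dl, every polynomial in n is a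
    polynomial in n^dl and loses against the exponential. *)
Lemma summable_exp_powR (R : realType) (dl : R) : 0 < dl ->
  (\sum_(n <oo) (4 * n.+1%:R ^+ 3 * expR (- (n%:R `^ dl / 32)))%:E < +oo)%E.
Proof.
move=> dl0.
pose k := Num.bound dl^-1.
have kdl : 1 <= dl * k%:R.
  have : dl^-1 < k%:R by apply: archi_boundP; rewrite invr_ge0 ltW.
  by rewrite -(ltr_pM2l dl0) mulfV ?gt_eqF// => /ltW.
pose D : R := 32 ^+ (5 * k).+1 * (5 * k).+1`!%:R.
have D0 : 0 <= D by rewrite mulr_ge0// exprn_ge0.
apply: (@nneseries_inverse_square _ _ (8 * 32 * D + 8)) => n.
  by rewrite !mulr_ge0 ?expR_ge0 ?exprn_ge0.
rewrite ler_pdivlMr ?mulr_gt0//.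
case: n => [|n].
  rewrite expr1n mulr1 powR0 ?gt_eqF// mul0r oppr0 expR0.
  have : 0 <= 8 * 32 * D by rewrite mulr_ge0.
  lra.
set N : R := n.+1%:R; have N1 : 1 <= N by rewrite ler1n.
have N0 : 0 <= N by exact: le_trans N1.
set e := expR _; have e0 : 0 <= e by exact: expR_ge0.
have -> : n.+2%:R = N + 1 by rewrite /N natr1.
have -> : n.+3%:R = N + 2 by rewrite /N -natrD addn2.
have x1 : 1 <= N `^ dl by rewrite -[1](powRr0 N) ler_powR// ltW.
have key : N ^+ 5 * e <= D.
  have Nx : N <= (N `^ dl) ^+ k.
    rewrite -powR_mulrn ?powR_ge0// -powRrM -[leLHS](powRr1 N0).
    exact: ler_powR.
  apply: (@le_trans _ _ ((N `^ dl) ^+ (5 * k).+1 * e)).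
    rewrite ler_wpM2r// (@le_trans _ _ ((N `^ dl) ^+ (5 * k)))//.
      by rewrite mulnC exprM lerXn2r// nnegrE ?exprn_ge0// ?powR_ge0.
    by rewrite ler_weXn2l.
  have y0 : 0 <= N `^ dl / 32 by rewrite divr_ge0 ?powR_ge0.
  have := expR_ge_pow (5 * k) y0; rewrite -/e /D.
  rewrite expr_div_n mulrAC ler_pdivrMr ?exprn_gt0//.
  by rewrite [X in _ <= X -> _]mulrC.
have N2 : (N + 1) ^+ 3 * ((N + 1) * (N + 2)) <= (2 * N) ^+ 4 * (3 * N).
  rewrite mulrA -exprSr ler_pM ?mulr_ge0 ?exprn_ge0 ?addr_ge0//; last by lra.
  by rewrite lerXn2r// ?nnegrE ?mulr_ge0 ?addr_ge0//; lra.
apply: (@le_trans _ _ (4 * ((2 * N) ^+ 4 * (3 * N)) * e)).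
  rewrite -mulrA [_ * (_ * e)]mulrA.
  rewrite [4 * _ * _ * _](_ : _ =
    4 * ((N + 1) ^+ 3 * ((N + 1) * (N + 2))) * e); last by ring.
  by rewrite ler_wpM2r// ler_wpM2l.
have -> : 4 * ((2 * N) ^+ 4 * (3 * N)) * e = 192 * (N ^+ 5 * e) by ring.
by have := key; lra.
Qed.

Section Typicality.
Context (d : measure_display) (T : measurableType d) (R : realType)
  (P : probability T R) (A : countType) (X : int -> T -> A).
Hypotheses (hX : random_process X) (hstat : stationary P X).
Implicit Types (t : int) (L : nat) (u s w : seq A).

Local Notation pastX t L := (fun omega => past (sample_path X omega) t%R L).
Local Notation q := (prob_word P X).

(** The deviation of a relative frequency from p(y | w), multiplied out so that
    no quotient is formed. *)
Definition atypical w (eps m : R) : set (seq A) :=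
  [set u | exists s y, [/\ suffix w s, m < (gains (suffix s) y u)%:R &
    eps * (hits (suffix s) u)%:R <
      `|(gains (suffix s) y u)%:R - cond_prob P X y w * (hits (suffix s) u)%:R| ] ].

(** A union bound over the L^2 recurrence rules, the two signs of the deviation
    and the letters y; the probabilities p(y | w) of the letters sum to at
    most 1. *)
Lemma prob_atypical_le w (eps m : R) L : memory_word P X w ->
  0 <= eps <= 1 -> 0 <= m ->
  (P (pastX 0 L @^-1` atypical w eps m) <=
    (4 * L%:R ^+ 3 * expR (- (eps ^+ 2 * m / 8)))%:E)%E.
Proof.
move=> hw /andP[eps0 eps1] m0.
pose I : finType := ('I_L * 'I_L * bool)%type.
(* The stake eps / 4 maximizes lam * eps - 2 * lam^2, with value eps^2 / 8. *)
pose lam (sg : bool) : R := if sg then eps / 4 else - (eps / 4).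
pose xi := eps ^+ 2 * m / 8.
pose E (i : I) y := pastX 0 L @^-1` [set u |
  (0 < gains (recurrence_rule w i.1.1 i.1.2) y u)%N /\
  xi <= surplus P X w y (recurrence_rule w i.1.1 i.1.2) (lam i.2) u].
have lamE sg : `|lam sg| <= 2^-1.
  by rewrite /lam ler_norml; case: sg; apply/andP; split; lra.
have mE i y : measurable (E i y) by exact: measurable_past.
have EP i y : (P (E i y) <= (2 * cond_prob P X y w * L%:R * expR (- xi))%:E)%E.
  by apply: surplus_tail_bound => // u /and3P[].
pose G y := pastX 0 (size w) @^-1` [set w] `&` X (0 + 1) @^-1` [set y].
have mG y : measurable (G y).
  by apply: measurableI; [exact: measurable_past_eq|exact: hX].
have tG : trivIset setT G.
  by move=> y1 y2 _ _ [omega [[_ /= <-] [_ /= <-]]].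
(* If q w = 0, then c = 0 by the convention on division, and all the events
   are null, as they should be. *)
pose c := 2 * L%:R * expR (- xi) / q w.
have c0 : 0 <= c by rewrite divr_ge0 ?prob_word_ge0// !mulr_ge0 ?expR_ge0.
have EI i : (P (\bigcup_y E i y) <= (2 * L%:R * expR (- xi))%:E)%E.
  have : (P (\bigcup_y E i y) <= c%:E * P (\bigcup_y G y))%E.
    have EG y : (P (E i y) <= c%:E * P (G y))%E.
      rewrite /G (prob_rcons hX hstat) -EFinM (le_trans (EP i y))// lee_fin.
      by rewrite (cond_probE hX hstat) /c le_eqVlt; apply/orP; left; apply/eqP; ring.
    exact: measure_le_countable.
  move=> /le_trans; apply.
  have Gw : (P (\bigcup_y G y) <= (q w)%:E)%E.
    rewrite -(prob_past hX hstat 0) le_measure ?inE//.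
    - by apply: countable_bigcupT_measurable => //; exact: countableP.
    - exact: measurable_past_eq.
    - by move=> omega [y _ []].
  apply: (@le_trans _ _ (c%:E * (q w)%:E)%E); first by rewrite lee_wpmul2l ?lee_fin.
  rewrite -EFinM lee_fin /c; have [->|w0] := eqVneq (q w) 0.
    by rewrite mulr0 !mulr_ge0 ?expR_ge0.
  by rewrite divfK.
have mEI i : measurable (\bigcup_y E i y).
  by apply: countable_bigcupT_measurable => //; exact: countableP.
have := finite_union_bound mEI EI.
rewrite !card_prod !card_ord card_bool => H.
apply: (@le_trans _ _ (P (\bigcup_i \bigcup_y E i y))); last first.
  apply: (le_trans H); rewrite lee_fin !natrM le_eqVlt; apply/orP; left.
  by apply/eqP; ring.
apply: le_measure; rewrite ?inE.
- exact: measurable_past.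
- by apply: countable_bigcupT_measurable => //; exact: countableP.
move=> omega /= [s [y [ws]]]; set u := past _ _ _ => mg dev.
have g0 : (0 < gains (suffix s) y u)%N by rewrite -(ltr0n R); exact: le_lt_trans mg.
have [[a b] gE hE] := first_occurrence ws g0.
rewrite gE in mg dev g0; rewrite hE in dev.
have uL : size u = L by rewrite size_past.
pose a' := cast_ord uL a; pose b' := cast_ord uL b.
pose D : R := (gains (recurrence_rule w a' b') y u)%:R -
  cond_prob P X y w * (hits (recurrence_rule w a' b') u)%:R.
(* The sign of the stake is the sign of the deviation D. *)
exists (a', b', 0 <= D) => //; exists y => //; split => //=.
rewrite /surplus -/D.
have mh : m < (hits (recurrence_rule w a' b') u)%:R.
  by rewrite (lt_le_trans mg)// ler_nat gains_le_hits.
move: dev; rewrite -/D -/(nat_of_ord a') -/(nat_of_ord b').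
set h : R := (hits _ _)%:R in mh * => dev.
have lamD : lam (0 <= D) * D = eps / 4 * `|D|.
  by rewrite /lam; case: ger0P => _ //; rewrite mulrN mulNr.
have lam2 : lam (0 <= D) ^+ 2 = eps ^+ 2 / 16.
  by rewrite /lam; case: (0 <= D); field.
rewrite lamD lam2 /xi.
have h1 : 0 <= eps * (`|D| - eps * h) by rewrite mulr_ge0 ?subr_ge0// ltW.
have h2 : 0 <= eps ^+ 2 * (h - m) by rewrite mulr_ge0 ?sqr_ge0 ?subr_ge0// ltW.
nra.
Qed.

Variables (gamma beta : R).
Hypotheses (hgamma : 0 < gamma < 1) (hbeta : 0 < beta < (1 - gamma) / 2).

(** With eps = n^(- beta) / 2 and m = n^(1 - gamma) the exponent eps^2 * m / 8
    is n^(1 - gamma - 2 beta) / 32, a positive power of n, so the bounds are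
    summable. *)
Lemma eventually_typical w : memory_word P X w ->
  {ae P, forall omega, \forall n \near \oo,
    ~ atypical w (n%:R `^ (- beta) / 2) (n%:R `^ (1 - gamma)) (pastX 0 n.+1 omega)}.
Proof.
move=> hw.
pose B n := pastX 0 n.+1 @^-1`
  atypical w (n%:R `^ (- beta) / 2) (n%:R `^ (1 - gamma)).
have mB n : measurable (B n) by exact: measurable_past.
have /andP[g0 g1] := hgamma; have /andP[b0 b1] := hbeta.
pose dl := 1 - gamma - 2 * beta.
have dl0 : 0 < dl by rewrite /dl; lra.
have PB n : (P (B n) <= (4 * n.+1%:R ^+ 3 * expR (- (n%:R `^ dl / 32)))%:E)%E.
  have n0 := powR_ge0 (n%:R : R) (- beta).
  have n1 : n%:R `^ (- beta) <= 1 :> R.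
    case: n {n0} => [|n]; first by rewrite powR0// oppr_eq0; lra.
    by rewrite -[leRHS](powRr0 n.+1%:R) ler_powR ?ler1n//; lra.
  apply: (le_trans (prob_atypical_le n.+1 hw _ (powR_ge0 _ _))).
    by apply/andP; split; lra.
  rewrite lee_fin ler_wpM2l ?mulr_ge0 ?exprn_ge0// ler_expR lerN2.
  have -> : n%:R `^ dl = (n%:R `^ (- beta)) ^+ 2 * n%:R `^ (1 - gamma) :> R.
    rewrite -powR_mulrn ?powR_ge0// -powRrM -powRD.
      by congr (_ `^ _); rewrite /dl; ring.
    by apply/implyP => /eqP; move: dl0; rewrite /dl; lra.
  by rewrite le_eqVlt; apply/orP; left; apply/eqP; field.
have sB : (\sum_(n <oo) P (B n) < +oo)%E.
  by apply: le_lt_trans (summable_exp_powR dl0); apply: lee_nneseries => // n _.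
have := lim_sup_set_cvg0 mB sB => B0.
have mL : measurable (lim_sup_set B).
  by apply: bigcapT_measurable => n; apply: bigcup_measurable.
apply: (@negligibleS _ _ _ _ (lim_sup_set B)); last exact/negligibleP.
move=> omega /= H n _; apply: contrapT => nB; apply: H.
exists n => // k /= nk Bk; apply: nB; exists k => //.
Qed.

End Typicality.

(** * The empirical quantities as counts along the window *)
Section Empirical.
Context (R : realType) (A : countType) (x : int -> A).
Implicit Types (n : nat) (u v w s : seq A) (y : A).

Local Notation U n := (past x 0%R n.+1).

Lemma onth_past t L j : (j < L)%N ->
  onth (past x t L) j = Some (x (t - L%:Z + 1 + j%:Z)).
Proof.
move=> jL; rewrite onthE /past /mkseq -map_comp (nth_map 0%N) ?size_iota//.
by rewrite /= nth_iota// add0n.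
Qed.

(** Time - n - 1 + j is that of the last letter of the prefix of length j of
    the window; prefixes shorter than k do not contain a word of length k. *)
Lemma count_zrange (f : int -> bool) (g : nat -> bool) n k :
  (forall j, (j < n.+1)%N -> g j = (k <= j)%N && f (- n%:Z - 1 + j%:Z)) ->
  count f (zrange (- n%:Z + k%:Z - 1) (- 1)) = count g (iota 0 n.+1).
Proof.
move=> fg; have [kn|nk] := leqP k n; last first.
  rewrite /zrange ifF; last by apply/negP; lia.
  apply/esym/eqP; rewrite -leqn0 leqNgt -has_count; apply/hasPn => j.
  rewrite mem_iota add0n /= => jn; rewrite fg//.
  by rewrite leqNgt (leq_trans jn nk).
rewrite /zrange ifT; last by lia.
have -> : (absz (- 1 - (- n%:Z + k%:Z - 1))%R).+1 = (n.+1 - k)%N by lia.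
have kn1 : (k <= n.+1)%N by exact: leqW.
rewrite -[in RHS](subnKC kn1) iotaD count_cat add0n.
rewrite (_ : count g (iota 0 k) = 0%N) ?add0n.
  rewrite -{3}[k]addn0 iotaDl !count_map; apply: eq_in_count => i.
  rewrite mem_iota add0n /= => ik.
  rewrite fg ?leq_addr /=; last by lia.
  by congr f; lia.
apply/eqP; rewrite -leqn0 leqNgt -has_count; apply/hasPn => j.
rewrite mem_iota add0n /= => jk; rewrite fg; last exact: leq_trans jk kn1.
by rewrite leqNgt jk.
Qed.

Lemma suffix_take_past n w j : (j < n.+1)%N ->
  suffix w (take j (U n)) = (size w <= j)%N &&
    (past x (- n%:Z - 1 + j%:Z) (size w) == w).
Proof.
move=> jn; rewrite take_past; last exact: ltnW.
have [wj|jw] := leqP (size w) j.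
  by rewrite suffix_past//=; congr (past x _ _ == _); lia.
by apply/negP => /size_suffix; rewrite size_past leqNgt jw.
Qed.

Lemma count_hits n w :
  count (fun t => seg x (t - (size w)%:Z + 1) t == w)
    (zrange (- n%:Z + (size w)%:Z - 1) (- 1)) = hits (suffix w) (U n).
Proof.
rewrite /hits size_past; apply: count_zrange => j jn.
rewrite suffix_take_past//; congr (_ && (_ == _)).
by rewrite (@seg_past _ _ _ _ (size w))//; lia.
Qed.

Lemma count_gains n y w :
  count (fun t => seg x (t - (size w)%:Z + 1) (t + 1) == rcons w y)
    (zrange (- n%:Z + (size w)%:Z - 1) (- 1)) = gains (suffix w) y (U n).
Proof.
rewrite /gains size_past; apply: count_zrange => j jn.
rewrite suffix_take_past// onth_past// -andbA; congr (_ && _).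
rewrite (@seg_past _ _ _ _ (size w).+1); last by lia.
rewrite pastS eqseq_rcons; congr (_ && _).
by rewrite (_ : 0 - n.+1%:Z + 1 + j%:Z = - n%:Z - 1 + j%:Z + 1)//; lia.
Qed.

Lemma emp_probE n y w :
  emp_prob R x n y w = (gains (suffix w) y (U n))%:R / (hits (suffix w) (U n))%:R.
Proof. by rewrite /emp_prob count_gains count_hits. Qed.

Lemma emp_prob_ge0 n y w : 0 <= emp_prob R x n y w.
Proof. by rewrite emp_probE divr_ge0. Qed.

Lemma emp_prob_le1 n y w : emp_prob R x n y w <= 1.
Proof.
rewrite emp_probE; have := gains_le_hits (suffix w) y (U n).
case: (hits _ _) => [|h] gh; first by rewrite invr0 mulr0.
by rewrite ler_pdivrMr ?ltr0n// mul1r ler_nat.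
Qed.

Lemma emp_prob_dist_le1 n y v w :
  `|emp_prob R x n y v - emp_prob R x n y w| <= 1.
Proof.
have := emp_prob_ge0 n y v; have := emp_prob_le1 n y v.
have := emp_prob_ge0 n y w; have := emp_prob_le1 n y w.
by move=> *; rewrite ler_norml; apply/andP; split; lra.
Qed.

Lemma frequentE (gamma : R) n y v (s : seq A) k : k = size v -> s = rcons v y ->
  frequent gamma x n k s <->
  n%:R `^ (1 - gamma) < (gains (suffix v) y (U n))%:R.
Proof.
move=> -> ->; rewrite /frequent /= -count_gains.
rewrite (_ : zrange (- n%:Z + (size v)%:Z) 0 =
    [seq t + 1 | t <- zrange (- n%:Z + (size v)%:Z - 1) (- 1)]); last first.
  rewrite /zrange [in RHS]fun_if /= -map_comp.
  have -> : (- n%:Z + (size v)%:Z - 1 <= -1) = (- n%:Z + (size v)%:Z <= 0) by lia.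
  case: ifP => // _.
  have -> : absz (- 1 - (- n%:Z + (size v)%:Z - 1))%R =
      absz (0 - (- n%:Z + (size v)%:Z))%R by lia.
  by congr (_ :: _); [lia|apply: eq_map => i /=; lia].
rewrite count_map; set c := count _ _; set c' := count _ _.
have -> : c = c'.
  apply: eq_count => t /=; rewrite (_ : t + 1 - (size v)%:Z = t - (size v)%:Z + 1)//.
  by lia.
by split => [[]|] //; rewrite size_rcons.
Qed.

(** An occurrence of v followed by y is an occurrence of the longer word; hits
    leaves out the one that ends where u ends. *)
Lemma gains_suffixE v y u : gains (suffix v) y u =
  (hits (suffix (rcons v y)) u + suffix (rcons v y) u)%N.
Proof.
elim/last_ind: u => [|u a IH]; first by rewrite /gains /hits /= suffixs0; case: v.
by rewrite gains_rcons hits_rcons IH suffix_rcons [a == y]eq_sym [(_ == _) && _]andbC.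
Qed.

Lemma gains_suffix_cat z w y u :
  (gains (suffix (z ++ w)) y u <= gains (suffix w) y u)%N.
Proof.
apply: sub_count => j /andP[zw ->]; rewrite andbT.
exact: catl_suffix zw.
Qed.

End Empirical.

Section PowersOfN.
Context (R : realType).

Lemma near_powRN_le (b eps : R) : 0 < b -> 0 < eps ->
  \forall n \near \oo, n%:R `^ (- b) <= eps.
Proof.
move=> b0 eps0; near=> n.
have n0 : 0 < n%:R :> R by rewrite ltr0n; near: n; exists 1%N.
rewrite powRN -[leRHS]invrK lef_pV2 ?posrE ?invr_gt0 ?powR_gt0//.
have C0 : 0 <= eps^-1 `^ b^-1 by exact: powR_ge0.
have -> : eps^-1 = (eps^-1 `^ b^-1) `^ b.
  by rewrite -powRrM mulVf ?gt_eqF// powRr1// invr_ge0 ltW.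
have Cn : eps^-1 `^ b^-1 <= n%:R.
  apply: (le_trans (ltW (archi_boundP C0))).
  by rewrite ler_nat; near: n; exact: nbhs_infty_ge.
by apply: ge0_ler_powR => //; rewrite ?nnegrE ltW.
Unshelve. all: by end_near. Qed.

End PowersOfN.

(** * The test and the estimator *)
Section Test.
Context (d : measure_display) (T : measurableType d) (R : realType)
  (P : probability T R) (A : countType) (X : int -> T -> A).
Variables (gamma beta : R) (x : int -> A).
Implicit Types (n : nat) (u v w s : seq A) (y : A).

Local Notation U n := (past x 0%R n.+1).
Local Notation q := (prob_word P X).

Lemma chiE n K : (K < n)%N ->
  ntest gamma beta x n (past x 0 K) ->
  (forall k, (k < K)%N -> ~~ ntest gamma beta x n (past x 0 k)) ->
  chi gamma beta x n = K.
Proof.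
move=> Kn tK tk; rewrite /chi.
have segE k : seg x (- k%:Z + 1) 0 = past x 0 k by apply: seg_past; lia.
set f := fun k => _; have fK : f K by rewrite /f segE.
have hasf : has f (iota 0 n).
  by apply/hasP; exists K => //; rewrite mem_iota.
apply/eqP; rewrite eqn_leq; apply/andP; split; rewrite leqNgt; apply/negP => lt.
  have := before_find 0%N lt; rewrite nth_iota// add0n fK//.
have := nth_find 0%N hasf; rewrite nth_iota ?add0n; last exact: ltn_trans lt Kn.
by rewrite /f segE (negPf (tk _ lt)).
Qed.

(** Every extension z w that is frequent together with y makes both z w and w
    frequent with y, so both empirical probabilities are within n^(- beta) / 2
    of p(y | w). *)
Lemma ntest_typical n w :
  ~ atypical P X w (n%:R `^ (- beta) / 2) (n%:R `^ (1 - gamma)) (U n) ->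
  ntest gamma beta x n w.
Proof.
move=> typ.
have dev s y : suffix w s -> n%:R `^ (1 - gamma) < (gains (suffix s) y (U n))%:R ->
    `|emp_prob R x n y s - cond_prob P X y w| <= n%:R `^ (- beta) / 2.
  move=> ws mg; rewrite emp_probE.
  have h0 : 0 < (hits (suffix s) (U n))%:R :> R.
    rewrite (lt_le_trans (le_lt_trans (powR_ge0 _ _) mg))// ler_nat.
    exact: gains_le_hits.
  rewrite -[cond_prob _ _ _ _](mulfK (lt0r_neq0 h0)) -mulrBl normrM normfV.
  rewrite (gtr0_norm h0) ler_pdivrMr// leNgt; apply/negP => D.
  by apply: typ; exists s, y.
rewrite /ntest /emp_delta; set S := [set r | _].
have [S0|/nonemptyPn ->] := pselect (S !=set0); last first.
  by rewrite sup0 powR_ge0.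
apply: ge_sup => // r [i [z [y [_ zi fr ->]]]].
have {fr} mg : n%:R `^ (1 - gamma) < (gains (suffix (z ++ w)) y (U n))%:R.
  apply/(@frequentE _ _ x gamma n y _ (z ++ rcons w y) (size w + i)%N) => //.
    by rewrite size_cat zi addnC.
  by rewrite rcons_cat.
have mg' : n%:R `^ (1 - gamma) < (gains (suffix w) y (U n))%:R.
  by rewrite (lt_le_trans mg)// ler_nat gains_suffix_cat.
have := dev _ y (suffix_suffix z w) mg; have := dev _ y (suffix_refl w) mg'.
rewrite !ler_norml => /andP[? ?] /andP[? ?]; apply/andP; split; lra.
Qed.

Hypotheses (hX : random_process X) (hstat : stationary P X).
Hypotheses (hgamma : 0 < gamma < 1) (hbeta : 0 < beta < (1 - gamma) / 2).
Hypothesis x_generic : forall s,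
  (hits (suffix s) (past x 0 L))%:R / L%:R @[L --> \oo] --> q s.

Lemma hits_window_cvg s :
  (hits (suffix s) (U n))%:R / n.+1%:R @[n --> \oo] --> q s.
Proof. by rewrite (cvg_shiftS (fun L => _ / L%:R : R)); exact: x_generic. Qed.

Lemma gains_window_cvg v y :
  (gains (suffix v) y (U n))%:R / n.+1%:R @[n --> \oo] --> q (rcons v y).
Proof.
under eq_fun do rewrite gains_suffixE natrD mulrDl.
rewrite -[q _]addr0; apply: cvgD; first exact: hits_window_cvg.
apply: (@squeeze_cvgr _ _ _ _ (fun=> 0) (fun n => n.+1%:R^-1)).
- apply: nearW => n; rewrite divr_ge0//= ler_pdivrMr// mulVf//.
  by case: (suffix _ _).
- exact: cvg_cst.
- exact: cvg_harmonic.
Qed.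

Lemma emp_prob_cvg v y : 0 < q v ->
  emp_prob R x n y v @[n --> \oo] --> cond_prob P X y v.
Proof.
move=> v0; rewrite (cond_probE hX hstat).
rewrite (_ : (fun n => _) = (fun n => (gains (suffix v) y (U n))%:R / n.+1%:R /
  ((hits (suffix v) (U n))%:R / n.+1%:R))); last first.
  apply/funext => n; rewrite emp_probE invfM invrK mulrACA.
  by rewrite mulVf ?mulr1// pnatr_eq0.
apply: cvgM; first exact: gains_window_cvg.
by apply: cvgV; [rewrite gt_eqF|exact: hits_window_cvg].
Qed.

(** Some extension z w of positive probability changes the probability of some
    letter y. The empirical probabilities converge to these two different
    numbers, while z w y occurs linearly often and the threshold n^(- beta)
    tends to 0. *)
Lemma ntest_not_memory w : ~ memory_word P X w ->
  \forall n \near \oo, ~~ ntest gamma beta x n w.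
Proof.
have /andP[g0 g1] := hgamma; have /andP[b0 b1] := hbeta.
move=> nw; have [i [y [z [i1 zi zwy neq]]]] : exists i y z,
    [/\ (1 <= i)%N, size z = i, 0 < q (z ++ rcons w y) &
      cond_prob P X y w <> cond_prob P X y (z ++ w)].
  apply: contrapT => H; apply: nw => i y z i1 zi zwy.
  by apply: contrapT => neq; apply: H; exists i, y, z.
have zwyE : z ++ rcons w y = rcons (z ++ w) y by rewrite rcons_cat.
have qzw : 0 < q (z ++ w).
  by rewrite (lt_le_trans zwy)// zwyE prob_word_rcons_le.
have qw : 0 < q w.
  by rewrite (lt_le_trans qzw)// prob_word_suffix_le// suffix_suffix.
pose c := `|cond_prob P X y w - cond_prob P X y (z ++ w)|.
have c0 : 0 < c by rewrite normr_gt0 subr_eq0; apply/eqP.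
have dcvg : `|emp_prob R x n y w - emp_prob R x n y (z ++ w)| @[n --> \oo] --> c.
  by apply: cvg_norm; apply: cvgB; exact: emp_prob_cvg.
have gcvg := @gains_window_cvg (z ++ w) y; rewrite -zwyE in gcvg.
near=> n.
have D : c / 2 < `|emp_prob R x n y w - emp_prob R x n y (z ++ w)|.
  by near: n; apply: (cvgr_gt _ dcvg); lra.
have G : q (z ++ rcons w y) / 2 <
    (gains (suffix (z ++ w)) y (U n))%:R / n.+1%:R.
  by near: n; apply: (cvgr_gt _ gcvg); lra.
have nb : n%:R `^ (- beta) <= c / 2.
  by near: n; apply: near_powRN_le; lra.
have ng : n%:R `^ (- gamma) <= q (z ++ rcons w y) / 2.
  by near: n; apply: near_powRN_le; lra.
have i_n : (i <= n)%N by near: n; exact: nbhs_infty_ge.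
have n0 : 0 < n%:R :> R by rewrite ltr0n (leq_trans i1).
rewrite /ntest -ltNge; apply: (le_lt_trans nb); apply: (lt_le_trans D).
rewrite /emp_delta; apply: ub_le_sup.
  exists 1 => r [i' [z' [y' [_ _ _ ->]]]].
  exact: emp_prob_dist_le1.
exists i, z, y; split => //; first by rewrite i1.
apply/(@frequentE _ _ x gamma n y (z ++ w)) => //.
  by rewrite size_cat zi addnC.
rewrite powRD; last by apply/implyP => _; rewrite gt_eqF.
rewrite powRr1 ?ltW//; rewrite ltr_pdivlMr// in G.
apply: le_lt_trans G; rewrite mulrC.
by apply: ler_pM => //; rewrite ?powR_ge0 ?ler_nat.
Unshelve. all: by end_near. Qed.

End Test.

Theorem theorem2 (d : measure_display) (T : measurableType d) (R : realType)
  (P : probability T R) (A : countType) (X : int -> T -> A) (gamma beta : R)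
  (hX : random_process X) (hstat : stationary P X) (herg : ergodic P X)
  (hfm : finitarily_markovian P X)
  (hgamma : 0 < gamma < 1) (hbeta : 0 < beta < (1 - gamma) / 2) :
  {ae P, forall omega : T, \forall n \near \oo,
    memory_length P X (sample_path X omega) =
      Some (chi gamma beta (sample_path X omega) n)}.
Proof.
have generic := hits_suffix_cvg hX hstat herg.
(* The memory word depends on the path, so one null set has to serve all
   words. *)
have typical : {ae P, forall omega, forall w, memory_word P X w ->
    \forall n \near \oo, ~ atypical P X w (n%:R `^ (- beta) / 2)
      (n%:R `^ (1 - gamma)) (past (sample_path X omega) 0 n.+1)}.
  apply: ae_forall_countable => w; have [hw|nw] := pselect (memory_word P X w).
    by apply: filterS (eventually_typical hX hstat hgamma hbeta hw).
  by apply: aeW.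
move: generic typical hfm; apply: filterS3 => omega gen typ.
set x := sample_path X omega in gen typ *.
rewrite /memory_length; case: pselect => // h _.
have segE k : seg x (- k%:Z + 1) 0 = past x 0 k by apply: seg_past; lia.
case: ex_minnP => K; rewrite /is_memory segE => /asboolP memK minK.
have pass : \forall n \near \oo, ntest gamma beta x n (past x 0 K).
  by apply: filterS (typ _ memK) => n; exact: ntest_typical.
have fail k : (k < K)%N ->
    \forall n \near \oo, ~~ ntest gamma beta x n (past x 0 k).
  move=> kK; apply: (ntest_not_memory hX hstat hgamma hbeta gen).
  move=> memk; have := minK k; rewrite /is_memory segE leqNgt kK => H.
  by have := H (asboolT memk).
have fails : \forall n \near \oo, forall k, (k < K)%N ->
    ~~ ntest gamma beta x n (past x 0 k).
  have : \forall n \near \oo, forall k : 'I_K, ~~ ntest gamma beta x n (past x 0 k).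
    by apply: filter_forall => k; exact: fail.
  by apply: filterS => n H k kK; exact: (H (Ordinal kK)).
have large : \forall n \near \oo, (K < n)%N by exact: nbhs_infty_gt.
near=> n; congr Some; apply/esym.
by apply: chiE; near: n.
Unshelve. all: by end_near. Qed.
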